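(* Let $p\in\left[\frac{p_0}{p_0-1},\infty\right]$ (where $\frac{p_0}{p_0-1}\approx 2.18006$), and let $C_{p,\infty}$ be the optimal (i.e. smallest) constant such that $$\left(\sum_{j,k=1}^{\infty}|A(e_j,e_k)|^{\frac{4p}{3p-2}}\right)^{\frac{3p-2}{4p}}\leq C_{p,\infty}\,\Vert A\Vert$$ for all continuous bilinear forms $A:\ell_p\times c_0\rightarrow\mathbb{R}$. Then $$2^{\frac12-\frac1p}\leq C_{p,\infty}\leq 2^{\frac12-\frac1{2p}}.$$
   Context: All spaces are real sequence spaces; $e_j$ denotes the $j$-th canonical unit vector, and $\Vert A\Vert=\sup|A(x,y)|$ over $x,y$ in the closed unit balls of the respective spaces. The number $p_0\approx 1.84742$ is the unique real number in the interval $(1,2)$ satisfying $\Gamma\left(\frac{p_0+1}{2}\right)=\frac{\sqrt{\pi}}{2}$, where $\Gamma$ is the Euler gamma function. Convention: when $p=\infty$, the space $\ell_p$ is replaced by $c_0$ (with the sup norm), $\frac1p$ and $\frac{1}{2p}$ are read as $0$, $\frac{4p}{3p-2}$ is read as $\frac43$ and $\frac{3p-2}{4p}$ as $\frac34$. *)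

(* Defs.v *)
From HB Require Import structures.
From mathcomp Require Import all_boot all_order all_algebra finmap.
From mathcomp Require Import all_classical all_reals all_analysis ess_sup_inf.
Set Implicit Arguments.
Unset Strict Implicit.
Unset Printing Implicit Defensive.
Import Order.TTheory GRing.Theory Num.Theory.
Import numFieldNormedType.Exports.
Local Open Scope classical_set_scope.
Local Open Scope ring_scope.

(* Euler's Gamma function, for s > 0. *)
Definition Gamma (R : realType) (s : R) : R :=
  \int[@lebesgue_measure R]_(t in `]0, +oo[) (t `^ (s - 1) * expR (- t)).

(* The real sequences with finite p-norm, restricted when p = +oo to those
   tending to 0: this is l_p for finite p >= 1 and c_0 for p = +oo. *)
Definition ell_set (R : realType) (p : \bar R) : set (nat -> R) :=
  [set x | finite_norm counting p x /\ (p = +oo%E -> x @ \oo --> (0 : R))].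

Definition ell_mem (R : realType) (p : \bar R) : {pred nat -> R} :=
  mem (ell_set p).

Record ell (R : realType) (p : \bar R) (p1 : (1 <= p)%E) := Ell {
  ell_val :> nat -> R ;
  _ : ell_val \in ell_mem p }.

HB.instance Definition _ (R : realType) (p : \bar R) (p1 : (1 <= p)%E) :=
  [isSub for @ell_val R p p1].
HB.instance Definition _ (R : realType) (p : \bar R) (p1 : (1 <= p)%E) :=
  [Choice of ell p1 by <:].

Section ell_normedModType.
Context (R : realType) (p : \bar R) (p1 : (1 <= p)%E).

Lemma finite_norm_Lfun (x : nat -> R) :
  finite_norm counting p x <-> x \in Lfun counting p.
Proof.
split=> [xp|xL]; last exact: set_mem (sub_Lfun_finLfun xL).
by apply/andP; split; apply: mem_set.
Qed.

Lemma ell_submod_closed : submod_closed (@ell_mem R p).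
Proof.
have [L0 LZD] := @Lfun_submod_closed _ nat R counting p p1.
split=> [|a x y].
  by rewrite inE; split; [exact/finite_norm_Lfun | move=> _; exact: cvg_cst].
rewrite !inE => -[xp x0] [yp y0]; split.
  by apply/finite_norm_Lfun/LZD; apply/finite_norm_Lfun.
move=> poo; have := cvgD (cvgZl_tmp (k := a) (x0 poo)) (y0 poo).
by rewrite scaler0 addr0; exact.
Qed.

HB.instance Definition _ :=
  GRing.isSubmodClosed.Build R (nat -> R) (@ell_mem R p) ell_submod_closed.

HB.instance Definition _ := [SubChoice_isSubLmodule of ell p1 by <:].

Lemma ell_finite_norm (x : ell p1) : finite_norm counting p x.
Proof. by case: x => x /= /set_mem[]. Qed.

Definition ell_norm (x : ell p1) : R := fine (Lnorm counting p (EFin \o x)).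

Lemma ell_normE (x : ell p1) :
  (ell_norm x)%:E = Lnorm counting p (EFin \o x).
Proof.
rewrite /ell_norm fineK// fin_numElt (lt_le_trans ltNy0) ?Lnorm_ge0//=.
exact: ell_finite_norm.
Qed.

Lemma ell_normD (x y : ell p1) : ell_norm (x + y) <= ell_norm x + ell_norm y.
Proof. by rewrite -lee_fin EFinD !ell_normE; exact: eminkowski. Qed.

Lemma ell_normZ (a : R) (x : ell p1) : ell_norm (a *: x) = `|a| * ell_norm x.
Proof.
apply/EFin_inj; rewrite EFinM !ell_normE.
have /finite_norm_Lfun xL := ell_finite_norm x.
exact: (@LnormZ _ nat R counting p p1 (Lfun_Sub p1 xL) a).
Qed.

Lemma ell_norm0_eq0 (x : ell p1) : ell_norm x = 0 -> x = 0.
Proof.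
move=> x0; have {}x0 : Lnorm counting p (EFin \o x) = 0%E.
  by rewrite -ell_normE x0.
have [//|A [_ A0 subA]] := Lnorm_eq0_eq0 _ (lt_le_trans lte01 p1) x0.
apply/val_inj/funext => k; apply: contrapT => xk.
have kA : [set k] `<=` A by move=> _ ->; apply: subA => /= /(_ I)[].
have : (@counting nat R [set k] <= 0)%E.
  by rewrite -A0; exact: (@le_measure _ R nat counting _ _ (mem_set I) (mem_set I)).
by rewrite /counting asboolT// fset_set1 cardfs1 lee_fin ler10.
Qed.

HB.instance Definition _ :=
  Lmodule_isNormed.Build R (ell p1) ell_normD ell_normZ ell_norm0_eq0.

(* The canonical unit vectors e_j, indexed from 0. *)
Lemma unit_seq_subproof (j : nat) :
  (fun k => (k == j)%:R : R) \in ell_mem p.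
Proof.
apply: mem_set; split; last first.
  move=> _; apply: (@cvg_near_cst _ _ (0 : R)).
  by exists j.+1 => // k /= jk; rewrite gtn_eqF.
rewrite /finite_norm; case: p p1 => [r r1| _ |//].
- have r0 : 0 < r by rewrite (lt_le_trans ltr01).
  rewrite Lnorm_counting//; apply: poweR_lty.
  rewrite (@nneseriesD1 _ _ j)//; last by move=> k _; exact: poweR_ge0.
  rewrite eseries0 ?adde0.
    by apply: poweR_lty; exact: ltry.
  by move=> k _ /= /negbTE ->; rewrite normr0 powR0// gt_eqF.
- rewrite unlock; case: ifPn => // _; apply: (@le_lt_trans _ _ 1%E); last exact: ltry.
  apply: (@ess_sup_ler _ _ _ _ (fun k => `|(k == j)%:R : R|)).
  by move=> k; rewrite lee_fin; case: (k == j); rewrite ?normr1 ?normr0.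
Qed.

Definition unit_seq (j : nat) : ell p1 := Ell p1 (unit_seq_subproof j).

End ell_normedModType.

Arguments unit_seq {R p p1} j.

Notation c0 R := (@ell R +oo%E (leey 1%E)).

(* ||A||, as an extended real: finite exactly when the bilinear A is
   continuous. *)
Definition bilin_norm (R : realType) (U V : normedModType R)
    (A : U -> V -> R) : \bar R :=
  ereal_sup [set (`|A x y|)%:E |
    x in [set x | `|x| <= 1] & y in [set y | `|y| <= 1]].

(* 1/p, read as 0 for p = +oo. *)
Definition inv_exp (R : realType) (p : \bar R) : R :=
  if p is r%:E then r^-1 else 0.

(* 4p/(3p-2), read as 4/3 for p = +oo. *)
Definition HL_exp (R : realType) (p : \bar R) : R :=
  if p is r%:E then 4 * r / (3 * r - 2) else 4 / 3.

(* C is an admissible constant in the inequality for forms on l_p x c_0; the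
   outer exponent (3p-2)/(4p) is the inverse of the inner one. *)
Definition HL_constant (R : realType) (p : \bar R) (p1 : (1 <= p)%E) (C : R) :
    Prop :=
  forall A : {bilinear ell p1 -> c0 R -> R},
    continuous (fun z : ell p1 * c0 R => A z.1 z.2) ->
    ((\esum_(jk in [set: nat * nat])
        (`|A (unit_seq jk.1) (unit_seq jk.2)| `^ HL_exp p)%:E) `^ (HL_exp p)^-1
      <= C%:E * bilin_norm A)%E.

Definition optimal_HL_constant (R : realType) (p : \bar R) (p1 : (1 <= p)%E)
    (C : R) : Prop :=
  HL_constant p1 C /\ forall C', HL_constant p1 C' -> C <= C'.

(* Main.v *)
Require Import Defs.
From HB Require Import structures.
From Stdlib Require Import ZArith.
From mathcomp Require Import all_boot all_order all_algebra.
From mathcomp Require Import all_classical all_reals all_analysis.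
From mathcomp Require Import finmap ess_sup_inf ring lra ssrZ.
Set Implicit Arguments.
Unset Strict Implicit.
Import Order.TTheory GRing.Theory Num.Theory.
Import numFieldNormedType.Exports.
Local Open Scope classical_set_scope.
Local Open Scope ring_scope.
Local Delimit Scope Z_scope with ZZ.


(** Write [q] for the conjugate exponent of [p], so that [1 <= q < 2], and
    [rho = 4q / (q + 2)] for the exponent of the inequality.

    Upper bound ([HL_constant_upper]).  By duality of [l_p] and [l_q]
    ([dual_ball]) a form of norm at most [N] has finite sections [a] with
    [sum_j |sum_k y_k a_jk|^q <= N^q] whenever all [|y_k| <= 1].  Averaging
    over signs [y_k] and applying Khinchine's inequality in [L^q] bounds the
    mixed norm [l_q (l_2)] of [a] taken by rows ([row_bound]).  The same norm
    taken by columns is bounded by Khinchine's inequality in [L^1], a duality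
    weight and Hoelder's inequality ([column_bound]).  Hoelder and Minkowski
    interpolate these two bounds into the [l_rho] norm of all entries
    ([mixed_interpolation]).  The product of the constants is at most
    [2 ^ (1 / (2q)) = 2 ^ (1/2 - 1/(2p))] as soon as the Khinchine constants in
    [L^q] are good enough ([finite_hardy_littlewood]).

    The constants that are needed all come from one case of Khinchine's
    inequality with its best constant, the exponent 4/3 ([khinchine43]): a
    signed sum [U] with coefficients of square sum 1/2 satisfies
    [E |U|^(4/3) >= 1/2], with equality for two coefficients 1/2.  Interpolation
    with the second moment below 4/3 ([khinchine_low]) and Jensen's inequality
    above it ([khinchine_high]) give the other exponents.

    For the exponent 4/3 the main tool is a minorant of [1080 |u|^(4/3)] made
    of [u^2], [u^4], [cos (pi u)], [cos (2 pi u)] and [cos (3 pi u)]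
    ([cos_test_le]).  It is exact at 0 and at 1 and -1, the values of the
    extremal sum.  The mean of a cosine over the signs is a product of
    cosines, so that Khinchine's inequality becomes an upper bound on three
    such products ([khinchine43_cos]).  This bound holds when the fourth moment
    of the coefficients is below 1/8 and the two largest
    have sum below 78/100
    ([khinchine43_one], [khinchine43_spread]).  The other sequences are treated
    directly ([khinchine43_large4], [khinchine43_two]).

    Lower bound ([HL_constant_lower]).  The Hadamard form
    [x0 y0 + x0 y1 + x1 y0 - x1 y1] has norm at most 2 and four entries of
    modulus 1, whence [4 ^ (1 / rho) <= 2 C], which is [2 ^ (1/2 - 1/p) <= C].

    The inequality is linear in the constant, so that the infimum of the
    admissible constants is admissible ([optimal_HL_constant_exists]). *)

(** * Positivity of polynomials on intervals *)

Section PolynomialPositivity.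
Variable R : realFieldType.

Definition ZtoR (z : Z) : R := (int_of_Z z)%:~R.

Lemma ZtoRD x y : ZtoR (x + y)%ZZ = ZtoR x + ZtoR y.
Proof. by rewrite /ZtoR -intrD -(raddfD int_of_Z). Qed.
Lemma ZtoRM x y : ZtoR (x * y)%ZZ = ZtoR x * ZtoR y.
Proof. by rewrite /ZtoR -intrM -(rmorphM int_of_Z). Qed.
Lemma ZtoRN x : ZtoR (- x)%ZZ = - ZtoR x.
Proof. by rewrite /ZtoR -mulrNz -(raddfN int_of_Z). Qed.
Lemma ZtoR0 : ZtoR 0 = 0. Proof. by []. Qed.
Lemma ZtoR_ge0 z : (0 <=? z)%ZZ -> 0 <= ZtoR z.
Proof. by case: z => //= p _; rewrite /ZtoR ler0z. Qed.

Lemma ZtoR_gt0 z : (0 <? z)%ZZ -> 0 < ZtoR z.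
Proof. by case: z => //= p _; rewrite /ZtoR /= ltr0n; apply/ssrnat.ltP; exact: Pos2Nat.is_pos. Qed.

(** Horner form in base 2: on a concrete [p] it simplifies to a closed term
    that linear arithmetic over [R] reads as a numeral. *)
Fixpoint posR (p : positive) : R :=
  match p with
  | xH => 1 | xO q => 2 * posR q | xI q => 1 + 2 * posR q
  end.

Lemma ZtoR_pos p : ZtoR (Zpos p) = posR p.
Proof.
elim: p => [p IH|p IH|] //=.
  by rewrite -IH Pos2Z.inj_xI ZtoRD ZtoRM addrC.
by rewrite -IH Pos2Z.inj_xO ZtoRM.
Qed.

Lemma ZtoR_neg p : ZtoR (Zneg p) = - posR p.
Proof. by rewrite -ZtoR_pos -ZtoRN. Qed.

(** Lists of integers are polynomials with the constant coefficient first. *)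
Fixpoint peval (p : seq Z) (x : R) : R :=
  if p is c :: p' then ZtoR c + x * peval p' x else 0.

Fixpoint padd (p q : seq Z) : seq Z :=
  match p, q with
  | [::], _ => q
  | _, [::] => p
  | a :: p', b :: q' => (a + b)%ZZ :: padd p' q'
  end.
Definition pscale (c : Z) (p : seq Z) := [seq (c * a)%ZZ | a <- p].
Fixpoint pmul (p q : seq Z) : seq Z :=
  if p is a :: p' then padd (pscale a q) (0%ZZ :: pmul p' q) else [::].

Lemma peval_add p q x : peval (padd p q) x = peval p x + peval q x.
Proof.
elim: p q => [|a p IH] [|b q] /=; rewrite ?add0r ?addr0 // IH ZtoRD; ring.
Qed.
Lemma peval_scale c p x : peval (pscale c p) x = ZtoR c * peval p x.
Proof. elim: p => [|a p IH] /=; rewrite ?mulr0 // IH ZtoRM; ring. Qed.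
Lemma peval_mul p q x : peval (pmul p q) x = peval p x * peval q x.
Proof.
elim: p => [|a p IH] /=; rewrite ?mul0r // peval_add peval_scale /= IH ZtoR0.
ring.
Qed.

Local Arguments pmul : simpl never.

(** Reified polynomials: the inequalities below are stated with [pexpr_eval],
    which simplifies to the usual notation, and decided on the integer lists
    [pnorm]. *)
Inductive pexpr :=
  | PX | PC of Z | PAdd of pexpr & pexpr | PMul of pexpr & pexpr
  | PPow of pexpr & nat.

Fixpoint pnorm (e : pexpr) : seq Z :=
  match e with
  | PX => [:: 0; 1]%ZZ
  | PC c => [:: c]
  | PAdd e1 e2 => padd (pnorm e1) (pnorm e2)
  | PMul e1 e2 => pmul (pnorm e1) (pnorm e2)
  | PPow e1 n => iter n (pmul (pnorm e1)) [:: 1%ZZ]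
  end.

Fixpoint pexpr_eval (e : pexpr) (x : R) : R :=
  match e with
  | PX => x
  | PC c => match c with
      | Z0 => 0 | Zpos p => posR p | Zneg p => - posR p end
  | PAdd e1 e2 => pexpr_eval e1 x + pexpr_eval e2 x
  | PMul e1 e2 => pexpr_eval e1 x * pexpr_eval e2 x
  | PPow e1 n => pexpr_eval e1 x ^+ n
  end.

Lemma ZtoRE z : ZtoR z = pexpr_eval (PC z) 0.
Proof. by case: z => [|p|p]; rewrite ?ZtoR_pos ?ZtoR_neg. Qed.

Lemma pnormE e x : peval (pnorm e) x = pexpr_eval e x.
Proof.
elim: e => [|c|e1 IH1 e2 IH2|e1 IH1 e2 IH2|e1 IH1 n] /=.
- by rewrite mulr0 addr0 add0r mulr1.
- by rewrite mulr0 addr0; case: c => [|p|p]; rewrite ?ZtoR_pos ?ZtoR_neg.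
- by rewrite peval_add IH1 IH2.
- by rewrite peval_mul IH1 IH2.
- elim: n => [|n IHn] /=; first by rewrite mulr0 addr0.
  by rewrite peval_mul IH1 IHn exprS.
Qed.

(** The numerator of [p ((a + b w) / (d + e w))] over the denominator
    [(d + e w) ^ size p], with that denominator. *)
Fixpoint moebius (a b d e : Z) (p : seq Z) : seq Z * seq Z :=
  if p is c :: p' then
    let: (h, D) := moebius a b d e p' in
    let D' := pmul [:: d; e] D in
    (padd (pscale c D') (pmul [:: a; b] h), D')
  else ([::], [:: 1%ZZ]).

Lemma moebiusE a b d e p w : let: (h, D) := moebius a b d e p in
  0 < ZtoR d + ZtoR e * w ->
  0 < peval D w /\
  peval h w = peval D w * peval p ((ZtoR a + ZtoR b * w) / (ZtoR d + ZtoR e * w)).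
Proof.
elim: p => [|c p]; first by move=> /= _; rewrite !mulr0 addr0 ltr01.
rewrite [moebius _ _ _ _ (_ :: _)]/=; case: moebius => h D IH De; case: (IH De) => D0 hE.
rewrite peval_add peval_scale !peval_mul hE /= !mulr0 !addr0.
rewrite ![w * _]mulrC mulr_gt0 //; split=> //.
by field; rewrite gt_eqF.
Qed.

Lemma peval_ge0 p w : all (Z.leb 0) p -> 0 <= w -> 0 <= peval p w.
Proof.
move=> + w0; elim: p => [|c p IH] //= /andP[c0 p0].
by rewrite addr_ge0 ?mulr_ge0 ?IH // ZtoR_ge0.
Qed.

(** A polynomial is nonnegative on an interval as soon as its numerator in
    the Moebius coordinate [w] of the interval, that is up to binomial factors
    its list of Bernstein coefficients, has only nonnegative entries. *)
Definition bernstein_on (p : seq Z) (den lo hi : Z) : bool :=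
  (0 <? den)%ZZ && all (Z.leb 0) (moebius lo hi den den p).1.

(** The interval from [lo / den] to the last of the [s_i / den] is subdivided
    at the points [s_i / den]; a polynomial with small positive minimum may have
    negative Bernstein coefficients on the whole interval. *)
Fixpoint bernstein_path (p : seq Z) (den lo : Z) (s : seq Z) : bool :=
  if s is hi :: s' then bernstein_on p den lo hi && bernstein_path p den hi s'
  else true.

Lemma bernstein_onP p den lo hi x : bernstein_on p den lo hi ->
  ZtoR lo <= ZtoR den * x -> ZtoR den * x < ZtoR hi -> 0 <= peval p x.
Proof.
move=> /andP[den0 ph] lox xhi.
have D0 : 0 < ZtoR den := ZtoR_gt0 den0.
(* x = (lo + hi w) / (den (1 + w)) *)
set w := (ZtoR den * x - ZtoR lo) / (ZtoR hi - ZtoR den * x).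
have hx : 0 < ZtoR hi - ZtoR den * x by rewrite subr_gt0.
have w0 : 0 <= w by rewrite divr_ge0 ?subr_ge0 // ltW.
have Dw : 0 < ZtoR den + ZtoR den * w by rewrite ltr_wpDr // mulr_ge0 // ltW.
have := @moebiusE lo hi den den p w.
case E : moebius ph => [h D] /= ph /(_ Dw)[Dp hE].
have lohi : ZtoR hi - ZtoR lo != 0 by rewrite subr_eq0 gt_eqF // (le_lt_trans lox).
have xE : (ZtoR lo + ZtoR hi * w) / (ZtoR den + ZtoR den * w) = x.
  apply: (mulIf (lt0r_neq0 Dw)); rewrite mulfVK ?gt_eqF // /w.
  by field; rewrite gt_eqF.
rewrite xE in hE.
by rewrite -(pmulr_rge0 _ Dp) -hE peval_ge0.
Qed.

Lemma bernstein_pathP e den lo s x : bernstein_path (pnorm e) den lo s ->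
  ZtoR lo <= ZtoR den * x -> ZtoR den * x < ZtoR (last lo s) ->
  0 <= pexpr_eval e x.
Proof.
rewrite -pnormE; elim: s lo => [|hi s IH] lo /=.
  by move=> _ lox /(le_lt_trans lox); rewrite ltxx.
move=> /andP[b1 b2] lox xl; case: (ltP (ZtoR den * x) (ZtoR hi)) => xhi.
  exact: bernstein_onP b1 lox xhi.
exact: IH b2 xhi xl.
Qed.

End PolynomialPositivity.

(** * Bounds on pi, on the cosine and on the exponential *)

Section CosineBounds.
Variable R : realType.
Implicit Types x y : R.

Lemma ge0_of_derive (f df : R -> R) :
  (forall x, is_derive x 1 f (df x)) -> 0 <= f 0 ->
  (forall x, 0 <= x -> 0 <= df x) -> forall x, 0 <= x -> 0 <= f x.
Proof.
move=> fd f0 dfp x x0; apply: le_trans f0 _.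
apply: (@ger0_derive1_ndecry _ f 0) => // [y|].
- rewrite in_itv /= andbT => /ltW y0; rewrite derive1E.
  by case: (fd y) => _ ->; exact: dfp.
- apply: continuous_subspaceT => y; apply: differentiable_continuous.
  by apply/derivable1_diffP; case: (fd y).
Qed.

Let is_derive_monomial n (c x : R) :
  is_derive x 1 (fun x => x ^+ n.+1 / c) (n.+1%:R * x ^+ n / c).
Proof.
have d := is_deriveZ c^-1 (@is_deriveX _ _ id n.+1 x 1 _ (is_derive_id x 1)).
have -> : (fun x => x ^+ n.+1 / c) = c^-1 \*: (@id R) ^+ n.+1.
  apply/funext => y; rewrite /GRing.scale /= mulrC; congr (_ * _).
  by elim: n {d} => [|n IH]; [rewrite !expr1 | rewrite exprS IH [in RHS]exprS].
by apply: is_derive_eq d _; rewrite /GRing.scale /=; ring.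
Qed.

(* Differentiating the alternating Taylor polynomials term by term gives the
   bounds on the sine and the cosine in turn, each from the previous one. *)
Lemma sin_le1 x : 0 <= x -> 0 <= x - sin x.
Proof.
apply: (@ge0_of_derive (fun x => x - sin x) (fun x => 1 - cos x)).
- by rewrite sin0 subr0.
- by move=> y _; rewrite subr_ge0 cos_le1.
Qed.

Let cos_ge2_ x : 0 <= x -> 0 <= cos x - (1 - x ^+ 2 / 2).
Proof.
apply: (@ge0_of_derive (fun x => cos x - (1 - x ^+ 2 / 2)) (fun x => x - sin x)).
- by move=> y; apply: is_derive_eq; rewrite /GRing.scale /=; field.
- by rewrite cos0; lra.
- exact: sin_le1.
Qed.

Let sin_ge3 x : 0 <= x -> 0 <= sin x - (x - x ^+ 3 / 6).
Proof.
apply: (@ge0_of_derive (fun x => sin x - (x - x ^+ 3 / 6)) (fun x => cos x - (1 - x ^+ 2 / 2))).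
- by move=> y; apply: is_derive_eq; rewrite /GRing.scale /=; field.
- by rewrite sin0; lra.
- exact: cos_ge2_.
Qed.

Let cos_le4_ x : 0 <= x -> 0 <= 1 - x ^+ 2 / 2 + x ^+ 4 / 24 - cos x.
Proof.
apply: (@ge0_of_derive (fun x => 1 - x ^+ 2 / 2 + x ^+ 4 / 24 - cos x) (fun x => sin x - (x - x ^+ 3 / 6))).
- by move=> y; apply: is_derive_eq; rewrite /GRing.scale /=; field.
- by rewrite cos0; lra.
- exact: sin_ge3.
Qed.

Let sin_le5 x : 0 <= x -> 0 <= x - x ^+ 3 / 6 + x ^+ 5 / 120 - sin x.
Proof.
apply: (@ge0_of_derive (fun x => x - x ^+ 3 / 6 + x ^+ 5 / 120 - sin x) (fun x => 1 - x ^+ 2 / 2 + x ^+ 4 / 24 - cos x)).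
- by move=> y; apply: is_derive_eq; rewrite /GRing.scale /=; field.
- by rewrite sin0; lra.
- exact: cos_le4_.
Qed.

Let cos_ge6_ x : 0 <= x ->
  0 <= cos x - (1 - x ^+ 2 / 2 + x ^+ 4 / 24 - x ^+ 6 / 720).
Proof.
apply: (@ge0_of_derive (fun x => cos x - (1 - x ^+ 2 / 2 + x ^+ 4 / 24 - x ^+ 6 / 720))
  (fun x => x - x ^+ 3 / 6 + x ^+ 5 / 120 - sin x)).
- move=> y.
  have d2 := is_derive_monomial 1 2 y; have d4 := is_derive_monomial 3 24 y.
  have d6 := is_derive_monomial 5 720 y.
  have d := is_deriveB (is_derive_cos y)
    (is_deriveB (is_deriveD (is_deriveB (is_derive_cst (1 : R) y 1) d2) d4) d6).
  by apply: is_derive_eq d _; field.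
- by rewrite cos0; lra.
- exact: sin_le5.
Qed.

Let cos_even (Q : R -> R -> Prop) : (forall x, 0 <= x -> Q (x ^+ 2) (cos x)) ->
  forall x, Q (x ^+ 2) (cos x).
Proof.
by move=> H x; rewrite -(cos_norm x) -[x ^+ 2]real_normK ?num_real //; exact: H.
Qed.

Lemma cos_ge2 x : 1 - x ^+ 2 / 2 <= cos x.
Proof.
apply: (@cos_even (fun z c => 1 - z / 2 <= c)) => {}x x0.
rewrite -subr_ge0; exact: cos_ge2_.
Qed.

Lemma cos_le4 x : cos x <= 1 - x ^+ 2 / 2 + (x ^+ 2) ^+ 2 / 24.
Proof.
apply: (@cos_even (fun z c => c <= 1 - z / 2 + z ^+ 2 / 24)) => {}x x0.
rewrite -exprM -subr_ge0; exact: cos_le4_.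
Qed.

Lemma cos_ge6 x :
  1 - x ^+ 2 / 2 + (x ^+ 2) ^+ 2 / 24 - (x ^+ 2) ^+ 3 / 720 <= cos x.
Proof.
apply: (@cos_even (fun z c => 1 - z / 2 + z ^+ 2 / 24 - z ^+ 3 / 720 <= c)) => {}x x0.
rewrite -!exprM -subr_ge0; exact: cos_ge6_.
Qed.

Lemma expRN_le2 y : 0 <= y -> expR (- y) <= 1 - y + y ^+ 2 / 2.
Proof.
have e0 x : 0 <= x -> 0 <= 1 - expR (- x).
  by move=> x0; rewrite subr_ge0 expR_le1 oppr_le0.
have e1 x : 0 <= x -> 0 <= expR (- x) - (1 - x).
  apply: (@ge0_of_derive (fun x => expR (- x) - (1 - x)) (fun x => 1 - expR (- x))).
  - by move=> z; apply: is_derive_eq; rewrite /GRing.scale /=; field.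
  - by rewrite oppr0 expR0; lra.
  - exact: e0.
move=> y0; rewrite -subr_ge0; move: y y0.
apply: (@ge0_of_derive (fun x => 1 - x + x ^+ 2 / 2 - expR (- x))
    (fun x => expR (- x) - (1 - x))).
- by move=> z; apply: is_derive_eq; rewrite /GRing.scale /=; field.
- by rewrite oppr0 expR0; lra.
- exact: e1.
Qed.

Lemma expRN_ge3 y : 0 <= y -> 1 - y + y ^+ 2 / 2 - y ^+ 3 / 6 <= expR (- y).
Proof.
move=> y0; rewrite -subr_ge0; move: y y0.
apply: (@ge0_of_derive (fun x => expR (- x) - (1 - x + x ^+ 2 / 2 - x ^+ 3 / 6))
    (fun x => 1 - x + x ^+ 2 / 2 - expR (- x))).
- by move=> z; apply: is_derive_eq; rewrite /GRing.scale /=; field.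
- by rewrite oppr0 expR0; lra.
- by move=> z z0; rewrite subr_ge0; exact: expRN_le2.
Qed.

(** The lower bound compares [cos (pi / 2) = 0] with a Taylor polynomial that
    bounds the cosine from below, the upper bound compares
    [cos (pi / 4) ^+ 2 = 1 / 2] with one that bounds it from above. *)
Lemma pi2_bounds : 98 / 10 <= pi ^+ 2 :> R /\ pi ^+ 2 <= 99 / 10 :> R.
Proof.
have p2 := @pi_ge2 R; have p4 : pi <= 4 :> R by have := @pihalf_lt2 R; lra.
have z4 : 4 <= pi ^+ 2 :> R by rewrite expr2; nra.
have z16 : pi ^+ 2 <= 16 :> R by rewrite expr2; nra.
split; rewrite leNgt; apply/negP => zb.
- have := cos_ge6 (pi / 2); rewrite cos_pihalf.
  have -> : (pi / 2 : R) ^+ 2 = pi ^+ 2 / 4 by field.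
  move: (pi ^+ 2 : R) z4 z16 zb => z z4 z16 zb.
  pose e := PAdd (PC 46080) (PAdd (PMul (PC (-5760)) PX)
    (PAdd (PMul (PC 120) (PPow PX 2)) (PMul (PC (-1)) (PPow PX 3)))).
  have := @bernstein_pathP R (PAdd e (PC (-1))) 10 40 [:: 98]%ZZ z ltac:(by vm_compute).
  by rewrite !ZtoRE /= => /(_ ltac:(lra) ltac:(lra)); lra.
- have c0 : 0 < cos (pi / 4 : R) by apply: cos_gt0_pihalf; lra.
  have c2 : cos (pi / 4 : R) ^+ 2 = 1 / 2.
    have := @cos_mulr2n R (pi / 4).
    have -> : pi / 4 *+ 2 = pi / 2 :> R by rewrite mulr2n; lra.
    rewrite cos_pihalf; lra.
  have := cos_le4 (pi / 4).
  have -> : (pi / 4 : R) ^+ 2 = pi ^+ 2 / 16 by field.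
  move: (pi ^+ 2 : R) z4 z16 zb => z z4 z16 zb cz.
  have : cos (pi / 4) <= 707 / 1000 :> R by nra.
  move: (cos _) c0 c2 {cz} => c c0 c2 cu.
  have : 0 <= (707 / 1000 - c) * (707 / 1000 + c) by apply: mulr_ge0; lra.
  lra.
Qed.

(** Both sides agree to order 2, and the term of order 4 of the cosine is
    smaller than that of the Gaussian. *)
Lemma cos_le_expR x : x ^+ 2 <= 4 -> cos x <= expR (- (x ^+ 2 / 2)).
Proof.
move=> x4; apply: le_trans (cos_le4 x) _.
apply: le_trans (@expRN_ge3 (x ^+ 2 / 2) _); last by rewrite divr_ge0 ?sqr_ge0.
have := sqr_ge0 x; move: (x ^+ 2) x4 => z z4 z0.
rewrite -subr_ge0.
have -> : 1 - z / 2 + (z / 2) ^+ 2 / 2 - (z / 2) ^+ 3 / 6 -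
   (1 - z / 2 + z ^+ 2 / 24) = z ^+ 2 * (4 - z) / 48 by field.
by rewrite divr_ge0 ?mulr_ge0 ?sqr_ge0 ?subr_ge0.
Qed.

(** The coefficient 1/12 of the expansion of [- ln (cos x)] is lowered to 1/14,
    which makes the estimate provable from the fourth-order Taylor polynomial. *)
Lemma cos_le_expR4 x : x ^+ 2 <= 205 / 100 ->
  cos x <= expR (- (x ^+ 2 / 2 + (x ^+ 2) ^+ 2 / 14)).
Proof.
move=> x2; apply: le_trans (cos_le4 x) _.
have x0 := sqr_ge0 x.
move: (x ^+ 2) x2 x0 => z z2 z0; apply: le_trans (@expRN_ge3 _ _); last first.
  have := sqr_ge0 z; lra.
rewrite -subr_ge0.
pose w := 1 + z / 7.
have -> : 1 - (z / 2 + z ^+ 2 / 14) + (z / 2 + z ^+ 2 / 14) ^+ 2 / 2 -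
   (z / 2 + z ^+ 2 / 14) ^+ 3 / 6 - (1 - z / 2 + z ^+ 2 / 24) =
   z ^+ 2 * (1 / 84 + z / 28 + z ^+ 2 / 392 - z / 48 * w ^+ 3).
  by rewrite /w; field.
apply: mulr_ge0; first exact: sqr_ge0.
pose e := PAdd (PC 196) (PAdd (PMul (PC 588) PX) (PAdd (PMul (PC 42) (PPow PX 2))
  (PMul (PC (-1)) (PMul PX (PPow (PAdd (PC 7) PX) 3))))).
have := @bernstein_pathP R e 10 0 [:: 21]%ZZ z ltac:(by vm_compute).
rewrite !ZtoRE /= => /(_ ltac:(lra) ltac:(lra)); rewrite /w; lra.
Qed.

End CosineBounds.

(** * The power 4/3 and a trigonometric minorant *)

Section Pow43.
Variable R : realType.
Implicit Types x u v t : R.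

Definition pow43 x : R := `|x| `^ (4 / 3).

Lemma pow43_cube v : 0 <= v -> pow43 (v ^+ 3) = v ^+ 4.
Proof.
move=> v0; rewrite /pow43 ger0_norm ?exprn_ge0 // -!powR_mulrn // -powRrM.
by congr (_ `^ _); field.
Qed.

Lemma cube_root x : 0 <= x -> exists2 v, 0 <= v & x = v ^+ 3.
Proof.
move=> x0; exists (x `^ 3^-1); first exact: powR_ge0.
by rewrite -powR_mulrn ?powR_ge0 // -powRrM mulVf ?powRr1.
Qed.

Lemma pow43N x : pow43 (- x) = pow43 x. Proof. by rewrite /pow43 normrN. Qed.
Lemma pow43_ge0 x : 0 <= pow43 x. Proof. exact: powR_ge0. Qed.

(** The parametrization [|x| = v ^+ 3] turns the inequalities on [pow43] into
    polynomial inequalities in [v]. *)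
Lemma pow43_norm x : exists2 v, 0 <= v & `|x| = v ^+ 3 /\ pow43 x = v ^+ 4.
Proof.
have [v v0 E] := cube_root (normr_ge0 x); exists v => //; split=> //.
by rewrite -(pow43_cube v0) -E /pow43 normr_id.
Qed.

(** The cubic Taylor polynomial at 1 is a lower bound: with [1 + t = v ^+ 3] the
    difference is [(v - 1) ^+ 4] times a polynomial with positive coefficients. *)
Lemma pow43_taylor1 t : - 1 <= t ->
  1 + 4 / 3 * t + 2 / 9 * t ^+ 2 - 4 / 81 * t ^+ 3 <= pow43 (1 + t).
Proof.
move=> t1; have [v v0 E] := @cube_root (1 + t) ltac:(lra).
rewrite E pow43_cube // -subr_ge0.
have -> : t = v ^+ 3 - 1 by rewrite -E; ring.
have -> : v ^+ 4 - (1 + 4 / 3 * (v ^+ 3 - 1) + 2 / 9 * (v ^+ 3 - 1) ^+ 2 -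
    4 / 81 * (v ^+ 3 - 1) ^+ 3) = ((v - 1) ^+ 2) ^+ 2 *
  (5 + 20 * v + 50 * v ^+ 2 + 40 * v ^+ 3 + 16 * v ^+ 4 + 4 * v ^+ 5) / 81.
  by field.
apply: divr_ge0 => //; apply: mulr_ge0; first exact: sqr_ge0.
by rewrite !addr_ge0 ?mulr_ge0 ?exprn_ge0.
Qed.

(** Young's inequality with exponents 4/3 and 4. *)
Lemma pow43_ge24 s x : 0 <= s ->
  (4 * s * x ^+ 2 - s ^+ 4 * x ^+ 4) / 3 <= pow43 x.
Proof.
move=> s0; have [v v0 [E ->]] := pow43_norm x.
have -> : x ^+ 4 = (x ^+ 2) ^+ 2 by ring.
rewrite -[x ^+ 2]real_normK ?num_real // E -subr_ge0.
have -> : v ^+ 4 - (4 * s * (v ^+ 3) ^+ 2 - s ^+ 4 * ((v ^+ 3) ^+ 2) ^+ 2) / 3 =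
  v ^+ 4 * ((s * v ^+ 2 - 1) ^+ 2 * ((s * v ^+ 2) ^+ 2 + 2 * (s * v ^+ 2) + 3)) / 3.
  by field.
apply: divr_ge0 => //; rewrite mulr_ge0 ?exprn_ge0 // mulr_ge0 ?sqr_ge0 //.
by rewrite !addr_ge0 ?mulr_ge0 ?exprn_ge0.
Qed.

Lemma pow43_tangent c u : 0 <= c -> 0 <= u ->
  c ^+ 4 + 4 / 3 * c * (u - c ^+ 3) <= pow43 u.
Proof.
move=> c0 u0; have [v v0 ->] := cube_root u0; rewrite pow43_cube // -subr_ge0.
have -> : v ^+ 4 - (c ^+ 4 + 4 / 3 * c * (v ^+ 3 - c ^+ 3)) =
  (v - c) ^+ 2 * (3 * v ^+ 2 + 2 * c * v + c ^+ 2) / 3 by field.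
apply: divr_ge0 => //; apply: mulr_ge0; first exact: sqr_ge0.
by rewrite !addr_ge0 ?mulr_ge0 ?exprn_ge0.
Qed.

Lemma pow43M x y : pow43 (x * y) = pow43 x * pow43 y.
Proof. by rewrite /pow43 normrM powRM. Qed.

(** The trigonometric part of [cos_test] in the variable [1 - cos (pi u)].
    Being increasing, it preserves upper bounds on that variable. *)
Definition test_cubic x := 283 * x - 78 * x ^+ 2 + 8 * x ^+ 3.

Lemma test_cubic_mono x y : x <= y -> test_cubic x <= test_cubic y.
Proof.
move=> xy; rewrite -subr_ge0 /test_cubic.
have -> : 283 * y - 78 * y ^+ 2 + 8 * y ^+ 3 - (283 * x - 78 * x ^+ 2 + 8 * x ^+ 3) =
  (y - x) * (6 * (x + y - 13 / 2) ^+ 2 + 59 / 2 + 2 * (x - y) ^+ 2) by field.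
apply: mulr_ge0; first by rewrite subr_ge0.
by have := sqr_ge0 (x + y - 13 / 2); have := sqr_ge0 (x - y); lra.
Qed.

(** The coefficients make [cos_test] agree with [1080 * pow43] at 0 and at 1,
    to first order at 1.  All cosines have negative coefficients, so that upper
    bounds on their means are enough. *)
Definition cos_test u : R := 804 * u ^+ 2 - 42 * u ^+ 4
  + 157 * (1 - cos (pi * u)) + 27 * (1 - cos (2 * (pi * u)))
  + 2 * (1 - cos (3 * (pi * u))).

Lemma cos_testE u :
  cos_test u = 804 * u ^+ 2 - 42 * u ^+ 4 + test_cubic (1 - cos (pi * u)).
Proof.
have c2 (x : R) : cos (2 * x) = 2 * cos x ^+ 2 - 1.
  by rewrite mulrC mulr_natr cos_mulr2n mulr_natl.
have c3 (x : R) : cos (3 * x) = 4 * cos x ^+ 3 - 3 * cos x.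
  have -> : 3 * x = x + 2 * x by ring.
  have s2 : sin (2 * x) = 2 * (cos x * sin x).
    by rewrite [2 * x]mulrC mulr_natr sin_mulr2n mulr_natl.
  rewrite cosD c2 s2.
  have -> : sin x * (2 * (cos x * sin x)) = 2 * cos x * sin x ^+ 2 by ring.
  by rewrite sin2cos2; ring.
rewrite /cos_test c2 c3 /test_cubic; ring.
Qed.

Let pi2l : 98 / 10 <= pi ^+ 2 :> R := (pi2_bounds R).1.
Let pi2u : pi ^+ 2 <= 99 / 10 :> R := (pi2_bounds R).2.

Let near0 u : 0 <= u -> u <= 34 / 100 -> cos_test u <= 1080 * pow43 u.
Proof.
move=> u0 u34; have [v v0 E] := cube_root u0.
have v2 : v ^+ 2 <= 24 / 49.
  rewrite leNgt; apply/negP => v2.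
  have : 699 / 1000 < v by rewrite ltNge; apply/negP => ?; nra.
  move=> v1; have : 34 / 100 < v ^+ 2 * v by nra.
  have -> : v ^+ 2 * v = v ^+ 3 by ring.
  rewrite -E; lra.
have X : 1 - cos (pi * u) <= 99 / 20 * u ^+ 2.
  have := @cos_ge2 R (pi * u); rewrite exprMn.
  have := ler_wpM2r (sqr_ge0 u) pi2u; lra.
rewrite cos_testE.
have XX := cos_geN1 (pi * u); have XX1 := cos_le1 (pi * u).
move: X XX XX1; set c := cos _ => X XX XX1.
have X0 : 0 <= 1 - c by lra.
have X2 : 1 - c <= 2 by lra.
have : test_cubic (1 - c) <= 283 * (99 / 20 * u ^+ 2).
  rewrite /test_cubic; move: (1 - c) X0 X2 X => X X0 X2 X3; nra.
rewrite E pow43_cube //.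
have -> : (v ^+ 3) ^+ 2 = v ^+ 2 * v ^+ 4 by ring.
have v4 : 0 <= v ^+ 4 by apply: exprn_ge0.
have : 0 <= (v ^+ 3) ^+ 4 by rewrite !exprn_ge0.
nra.
Qed.

(* Around the contact point 1, where the difference vanishes to order 2, the
   factor [t ^+ 2] is divided out before positivity is checked. *)
Let near1 t : - (66 / 100) <= t -> t < 90 / 100 ->
  cos_test (1 + t) <= 1080 * pow43 (1 + t).
Proof.
move=> t1 t2; apply: le_trans (ler_wpM2l _ (@pow43_taylor1 t _)); [|lra..].
rewrite cos_testE.
pose y := (1225 - 1021 * t ^+ 2) / 250.
have X : 1 - cos (pi * (1 + t)) <= 2 - t ^+ 2 * y.
  have -> : pi * (1 + t) = pi * t + pi by ring.
  rewrite cosDpi.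
  have := @cos_le4 R (pi * t); rewrite exprMn /y.
  have := sqr_ge0 t; move: (t ^+ 2) (pi ^+ 2) pi2l pi2u => T p p1 p2 T0.
  have p3 : p ^+ 2 <= 98 + 1 / 100 by nra.
  have := ler_wpM2r T0 p1; have := ler_wpM2r (sqr_ge0 T) p3.
  by have := sqr_ge0 T; rewrite exprMn; lra.
have := test_cubic_mono X; set G := test_cubic (1 - _) => G1.
suff : 804 * (1 + t) ^+ 2 - 42 * (1 + t) ^+ 4 + test_cubic (2 - t ^+ 2 * y) <=
  1080 * (1 + 4 / 3 * t + 2 / 9 * t ^+ 2 - 4 / 81 * t ^+ 3) by lra.
rewrite -subr_ge0 /test_cubic.
pose N := PAdd (PC 1225) (PMul (PC (-1021)) (PPow PX 2)).
pose e := PAdd (PMul (PC 15625000) (PAdd (PC (-936)) (PAdd (PMul (PC 344) PX) (PMul (PC 126) (PPow PX 2)))))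
  (PAdd (PMul (PC 12562500) N) (PAdd (PMul (PC 22500) (PMul (PPow PX 2) (PPow N 2)))
   (PMul (PC 24) (PMul (PPow PX 4) (PPow N 3))))).
have q0 : 0 <= pexpr_eval e t.
  apply: (@bernstein_pathP R e 100 (-66) [:: 12; 90]%ZZ t).
  - by vm_compute.
  - rewrite !ZtoRE /=; lra.
  - rewrite !ZtoRE /=; lra.
have -> : 1080 * (1 + 4 / 3 * t + 2 / 9 * t ^+ 2 - 4 / 81 * t ^+ 3) -
  (804 * (1 + t) ^+ 2 - 42 * (1 + t) ^+ 4 +
   (283 * (2 - t ^+ 2 * y) - 78 * (2 - t ^+ 2 * y) ^+ 2 +
    8 * (2 - t ^+ 2 * y) ^+ 3)) = t ^+ 2 * pexpr_eval e t / (3 * 250 ^+ 3).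
  by rewrite /y /=; field.
apply: divr_ge0; last lra.
by apply: mulr_ge0; [exact: sqr_ge0|exact: q0].
Qed.

(* Around 2 the cosines return to 1 and the test function is again close to
   its polynomial part. *)
Let near2 t : - (10 / 100) <= t -> t < 60 / 100 ->
  cos_test (2 + t) <= 1080 * pow43 (2 + t).
Proof.
move=> t1 t2.
have -> : 2 + t = 1 + (1 + t) by ring.
apply: le_trans (ler_wpM2l _ (@pow43_taylor1 (1 + t) _)); [|lra..].
rewrite cos_testE.
pose x := (99 * t ^+ 2 - 80 * t ^+ 4 + 27 * t ^+ 6) / 20.
have X : 1 - cos (pi * (1 + (1 + t))) <= x.
  have -> : pi * (1 + (1 + t)) = pi * t + pi *+ 2 by rewrite mulr2n; ring.
  rewrite cosD2pi.
  have := @cos_ge6 R (pi * t); rewrite exprMn /x.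
  have -> : t ^+ 4 = (t ^+ 2) ^+ 2 by ring.
  have -> : t ^+ 6 = (t ^+ 2) ^+ 3 by ring.
  have := sqr_ge0 t; move: (t ^+ 2) (pi ^+ 2) pi2l pi2u => T p p1 p2 T0.
  have p3 : p ^+ 3 <= 4852 / 5 by nra.
  have p4 : 2401 / 25 <= p ^+ 2 by nra.
  have := ler_wpM2r T0 p2.
  have := ler_wpM2r (sqr_ge0 T) p4.
  have := ler_wpM2r (exprn_ge0 3 T0) p3.
  have := sqr_ge0 T; have := exprn_ge0 3 T0.
  by rewrite !exprMn; lra.
have := test_cubic_mono X; set G := test_cubic (1 - _) => G1.
suff : 804 * (1 + (1 + t)) ^+ 2 - 42 * (1 + (1 + t)) ^+ 4 + test_cubic x <=
  1080 * (1 + 4 / 3 * (1 + t) + 2 / 9 * (1 + t) ^+ 2 - 4 / 81 * (1 + t) ^+ 3) by lra.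
rewrite -subr_ge0 /test_cubic.
pose N := PAdd (PMul (PC 99) (PPow PX 2)) (PAdd (PMul (PC (-80)) (PPow PX 4)) (PMul (PC 27) (PPow PX 6))).
pose H := PAdd (PC 1) PX.
pose e := PAdd (PMul (PC 8000) (PAdd (PC 3240) (PAdd (PMul (PC 4320) H) (PAdd (PMul (PC 720) (PPow H 2))
    (PAdd (PMul (PC (-160)) (PPow H 3)) (PAdd (PMul (PC (-2412)) (PPow (PAdd (PC 1) H) 2)) (PMul (PC 126) (PPow (PAdd (PC 1) H) 4))))))))
  (PAdd (PMul (PC (-339600)) N) (PAdd (PMul (PC 4680) (PPow N 2)) (PMul (PC (-24)) (PPow N 3)))).
have q0 : 0 <= pexpr_eval e t.
  apply: (@bernstein_pathP R e 100 (-10) [:: 20; 40; 50; 60]%ZZ t).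
  - by vm_compute.
  - rewrite !ZtoRE /=; lra.
  - rewrite !ZtoRE /=; lra.
have -> : 1080 * (1 + 4 / 3 * (1 + t) + 2 / 9 * (1 + t) ^+ 2 - 4 / 81 * (1 + t) ^+ 3) -
  (804 * (1 + (1 + t)) ^+ 2 - 42 * (1 + (1 + t)) ^+ 4 +
   (283 * x - 78 * x ^+ 2 + 8 * x ^+ 3)) = pexpr_eval e t / (24 * 1000).
  by rewrite /x /=; field.
by apply: divr_ge0; [exact: q0|lra].
Qed.

(* Far away the quartic term wins; (11/8) ^+ 3 is close to 26/10. *)
Let large u : 26 / 10 <= u -> cos_test u <= 1080 * pow43 u.
Proof.
move=> u26; have u0 : 0 <= u by lra.
have := @pow43_tangent (11 / 8) u ltac:(lra) u0.
rewrite cos_testE.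
have X : 1 - cos (pi * u) <= 2 by have := cos_geN1 (pi * u); lra.
have := test_cubic_mono X; set G := test_cubic (1 - _).
rewrite /test_cubic => G1; move: (pow43 u) => q.
move: u0 G G1 {X}; have [h h0 ->] : exists2 h, 0 <= h & u = 26 / 10 + h.
  by exists (u - 26 / 10); [lra|ring].
move=> _ G G1.
have h2 := exprn_ge0 2 h0; have h3 := exprn_ge0 3 h0; have h4 := exprn_ge0 4 h0.
lra.
Qed.

(** The bound is reduced to polynomial inequalities on four ranges: Taylor
    bounds for the cosine and for [pow43] around 1 and around 2, crude bounds
    near 0 and at infinity. *)
Lemma cos_test_le u : cos_test u <= 1080 * pow43 u.
Proof.
wlog u0 : u / 0 <= u => [H|].
  case: (leP 0 u) => [|u0]; first exact: H.
  have -> : cos_test u = cos_test (- u).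
    rewrite /cos_test !mulrN !cosN.
    have -> : (- u) ^+ 2 = u ^+ 2 by ring.
    by have -> : (- u) ^+ 4 = u ^+ 4 by ring.
  by rewrite -pow43N; apply: H; lra.
case: (leP u (34 / 100)) => u1; first exact: near0.
case: (ltP u (19 / 10)) => u2.
  by rewrite -[u](subrKC 1); apply: near1; lra.
case: (ltP u (26 / 10)) => u3; last exact: large.
by rewrite -[u](subrKC 2); apply: near2; lra.
Qed.

End Pow43.

(** * Rademacher means *)

Section RademacherMean.
Variable R : realType.

(** The mean of [phi (+-a_1 +- ... +- a_n)] over all choices of signs, with one
    sign averaged out at each step. *)
Fixpoint rad (V : zmodType) (l : seq V) (phi : V -> R) : R :=
  if l is a :: l' then
    (rad l' (fun x => phi (x + a)) + rad l' (fun x => phi (x - a))) / 2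
  else phi 0.

Section General.
Variable V : zmodType.
Implicit Types (l : seq V) (phi psi : V -> R) (a : V).

Lemma eq_rad l phi psi : phi =1 psi -> rad l phi = rad l psi.
Proof.
elim: l phi psi => [|a l IH] phi psi E /=; first exact: E.
by congr ((_ + _) / _); apply: IH => x; exact: E.
Qed.

Lemma ler_rad l phi psi : (forall x, phi x <= psi x) -> rad l phi <= rad l psi.
Proof.
elim: l phi psi => [|a l IH] phi psi E /=; first exact: E.
by rewrite ler_wpM2r ?invr_ge0 // lerD // IH.
Qed.

Lemma radD l phi psi : rad l (fun x => phi x + psi x) = rad l phi + rad l psi.
Proof.
elim: l phi psi => [|a l IH] phi psi //=; rewrite !IH; lra.
Qed.

Lemma radZ l c phi : rad l (fun x => c * phi x) = c * rad l phi.
Proof.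
elim: l phi => [|a l IH] phi //=; rewrite !IH; lra.
Qed.

Lemma rad_cst l c : rad l (fun=> c) = c.
Proof. elim: l => [|a l IH] //=; rewrite IH; lra. Qed.

Lemma rad_sum l (I : Type) (r : seq I) (phi : I -> V -> R) :
  rad l (fun x => \sum_(i <- r) phi i x) = \sum_(i <- r) rad l (phi i).
Proof.
elim: r => [|i r IH].
  by rewrite big_nil -[RHS](rad_cst l); apply: eq_rad => x; rewrite big_nil.
rewrite big_cons -IH -radD; apply: eq_rad => x; by rewrite big_cons.
Qed.

(** The signs may be averaged out in any order. *)
Lemma rad_cat_cons l1 a l2 phi : rad (l1 ++ a :: l2) phi = rad (a :: l1 ++ l2) phi.
Proof.
elim: l1 phi => [|b l1 IH] phi //=; rewrite !IH /=.
set A := rad _ (fun x => phi (x + a + b)); set B := rad _ (fun x => phi (x - a + b)).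
set C := rad _ (fun x => phi (x + a - b)); set D := rad _ (fun x => phi (x - a - b)).
have -> : rad (l1 ++ l2) (fun x => phi (x + b + a)) = A by apply: eq_rad => x; rewrite addrAC.
have -> : rad (l1 ++ l2) (fun x => phi (x - b + a)) = C by apply: eq_rad => x; rewrite addrAC.
have -> : rad (l1 ++ l2) (fun x => phi (x + b - a)) = B by apply: eq_rad => x; rewrite addrAC.
have -> : rad (l1 ++ l2) (fun x => phi (x - b - a)) = D by apply: eq_rad => x; rewrite addrAC.
by congr (_ / _); lra.
Qed.

Lemma rad_perm l l' phi : perm_eq l l' -> rad l phi = rad l' phi.
Proof.
elim: l l' phi => [|a l IH] l' phi; first by rewrite perm_sym => /perm_nilP ->.
move=> pl; have al' : a \in l' by rewrite -(perm_mem pl) mem_head.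
move: pl; case/splitPr: al' => l1 l2.
rewrite perm_sym -cat1s perm_catCA /= perm_cons perm_sym => pl.
by rewrite rad_cat_cons /= !(IH (l1 ++ l2)).
Qed.

Lemma rad_opp l phi : rad l (fun x => phi (- x)) = rad l phi.
Proof.
elim: l phi => [|a l IH] phi /=; first by rewrite oppr0.
rewrite -(IH (fun x => phi (x + a))) -(IH (fun x => phi (x - a))).
rewrite addrC; congr ((_ + _) / _); apply: eq_rad => x; congr phi; rewrite opprD //.
by rewrite opprK.
Qed.

Lemma rad_shift0 l phi : rad (0 :: l) phi = rad l phi.
Proof.
rewrite /= -[RHS](mulfK (x := 2)) ?pnatr_eq0 // [_ * 2]mulr_natr mulr2n.
by congr ((_ + _) / _); apply: eq_rad => x; rewrite ?subr0 ?addr0.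
Qed.

End General.

Lemma rad_map (U V : zmodType) (f : U -> V) (l : seq U) (phi : V -> R) :
  {morph f : x y / x + y} -> {morph f : x / - x} ->
  rad [seq f a | a <- l] phi = rad l (fun x => phi (f x)).
Proof.
move=> fD fN; have f0 : f 0 = 0.
  by apply: (addIr (f 0)); rewrite -fD !add0r.
elim: l phi => [|a l IH] phi /=; first by rewrite f0.
rewrite !IH; congr ((_ + _) / _); apply: eq_rad => x; by rewrite fD ?fN.
Qed.

(** Some choice of signs does at least as well as the average one. *)
Lemma rad_le_exists (V : lmodType R) (I : eqType) (v : I -> V) (s : seq I)
    (phi : V -> R) : uniq s ->
  exists2 y : I -> R, forall i, `|y i| <= 1 &
    rad [seq v i | i <- s] phi <= phi (\sum_(i <- s) y i *: v i).
Proof.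
elim: s phi => [|k s IH] phi.
  by exists (fun=> 0) => [i|]; rewrite ?normr0 ?big_nil.
move=> /= /andP[ks us].
have [y1 b1 h1] := IH (fun x => phi (x + v k)) us.
have [y2 b2 h2] := IH (fun x => phi (x - v k)) us.
have ext (y : I -> R) (e : R) : (\sum_(i <- k :: s) (if i == k then e else y i) *: v i)
    = \sum_(i <- s) y i *: v i + e *: v k.
  rewrite big_cons eqxx addrC; congr (_ + _); apply: eq_big_seq => i is_.
  by case: eqP => // ik; rewrite -ik is_ in ks.
have bd (y : I -> R) (e : R) : (forall i, `|y i| <= 1) -> `|e| <= 1 ->
    forall i, `|if i == k then e else y i| <= 1 by move=> ? ? i; case: eqP.
have [le12|lt21] := leP (rad [seq v i | i <- s] (fun x => phi (x + v k)))
  (rad [seq v i | i <- s] (fun x => phi (x - v k))).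
  exists (fun i => if i == k then - 1 else y2 i); first by apply: bd; rewrite ?normrN1.
  rewrite ext scaleN1r; apply: le_trans h2; lra.
exists (fun i => if i == k then 1 else y1 i); first by apply: bd; rewrite ?normr1.
rewrite ext scale1r; apply: le_trans h1; lra.
Qed.

Section Scalar.
Implicit Types (l : seq R) (phi : R -> R).

Definition sumpow (n : nat) l : R := \sum_(a <- l) a ^+ n.

Lemma rad_norm l phi : rad [seq `|a| | a <- l] phi = rad l phi.
Proof.
elim: l phi => [|a l IH] phi //=; rewrite !IH.
by case: (ger0P a) => // _; rewrite opprK addrC.
Qed.

Lemma rad_sqr l c : rad l (fun x => (c + x) ^+ 2) = c ^+ 2 + sumpow 2 l.
Proof.
rewrite /sumpow; elim: l c => [|a l IH] c; first by rewrite /= big_nil !addr0.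
rewrite big_cons /=.
rewrite (@eq_rad _ l _ (fun x => ((c + a) + x) ^+ 2)); last by move=> x; congr (_ ^+ 2); ring.
rewrite (@eq_rad _ l (fun x => (c + (x - a)) ^+ 2) (fun x => ((c - a) + x) ^+ 2)); last first.
  by move=> x; congr (_ ^+ 2); ring.
by rewrite !IH; field.
Qed.

Lemma rad_pow4 l c : rad l (fun x => (c + x) ^+ 4) =
  c ^+ 4 + 6 * c ^+ 2 * sumpow 2 l + 3 * sumpow 2 l ^+ 2 - 2 * sumpow 4 l.
Proof.
rewrite /sumpow; elim: l c => [|a l IH] c; first by rewrite /= !big_nil; ring.
rewrite !big_cons /=.
rewrite (@eq_rad _ l _ (fun x => ((c + a) + x) ^+ 4)); last by move=> x; congr (_ ^+ 4); ring.
rewrite (@eq_rad _ l (fun x => (c + (x - a)) ^+ 4) (fun x => ((c - a) + x) ^+ 4)); last first.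
  by move=> x; congr (_ ^+ 4); ring.
by rewrite !IH; field.
Qed.

(** Independence: the mean of [cos] factors over the signs. *)
Lemma rad_cos l t c :
  rad l (fun x => cos (t * (c + x))) = cos (t * c) * \prod_(a <- l) cos (t * a).
Proof.
elim: l c => [|a l IH] c; first by rewrite /= big_nil addr0 mulr1.
rewrite big_cons /=.
rewrite (@eq_rad _ l _ (fun x => cos (t * ((c + a) + x)))); last by move=> x; congr (cos (_ * _)); ring.
rewrite (@eq_rad _ l (fun x => cos (t * (c + (x - a)))) (fun x => cos (t * ((c - a) + x)))); last first.
  by move=> x; congr (cos (_ * _)); ring.
by rewrite !IH mulrDr mulrBr cosD cosB; field.
Qed.

Lemma sumpow_ge0 n l : ~~ odd n -> 0 <= sumpow n l.
Proof. by move=> nn; apply: sumr_ge0 => a _; exact: exprn_even_ge0. Qed.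

Lemma rad_pow4_le l c :
  rad l (fun x => (c + x) ^+ 4) <= 3 * (c ^+ 2 + sumpow 2 l) ^+ 2.
Proof.
rewrite rad_pow4; have := sumpow_ge0 l (isT : ~~ odd 4); have := sqr_ge0 (c ^+ 2).
move: (sumpow 4 l) (sumpow 2 l) => m r; have -> : c ^+ 4 = (c ^+ 2) ^+ 2 by ring.
move: (c ^+ 2) => d; lra.
Qed.

End Scalar.

(** A second-order gain over Jensen's inequality, which would give 1 on the left.
    The coefficient 22/100 is just below the value 2/9 of the Taylor expansion. *)
Lemma pow43_gain (y : R) : 1 + 22 / 100 * y ^+ 2 - 3 / 10 / 1000 * y ^+ 4 <=
  (pow43 (1 + y) + pow43 (1 - y)) / 2.
Proof.
wlog y0 : y / 0 <= y => [H|].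
  case: (leP 0 y) => y0; first exact: H.
  have := H (- y) ltac:(lra); rewrite opprK.
  have -> : (- y) ^+ 2 = y ^+ 2 by ring.
  have -> : (- y) ^+ 4 = y ^+ 4 by ring.
  lra.
have y4 := exprn_ge0 4 y0; have y2 := exprn_ge0 2 y0.
case: (leP y 1) => y1.
  have := @pow43_taylor1 _ y ltac:(lra); have := @pow43_taylor1 _ (- y) ltac:(lra).
  have -> : (- y) ^+ 2 = y ^+ 2 by ring.
  have -> : (- y) ^+ 3 = - y ^+ 3 by ring.
  lra.
rewrite -(pow43N (1 - y)) opprB.
(* (5/4) ^+ 3 is close to 1 + y on this range *)
case: (ltP y (13 / 10)) => y13.
  have := @pow43_tangent _ (5 / 4) (1 + y) ltac:(lra) ltac:(lra).
  have := pow43_ge0 (y - 1).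
  have : y ^+ 2 <= 1 + 23 / 10 * (y - 1) by rewrite expr2; nra.
  lra.
(* by convexity the mean is at least pow43 y *)
have [w w0 E] := cube_root y0.
have := @pow43_tangent _ w (1 + y) w0 ltac:(lra).
have := @pow43_tangent _ w (y - 1) w0 ltac:(lra).
rewrite -E => t1 t2.
suff : 1 + 22 / 100 * y ^+ 2 - 3 / 10 / 1000 * y ^+ 4 <= w ^+ 4 by lra.
rewrite E -!exprM.
have w109 : 109 / 100 <= w.
  rewrite leNgt; apply/negP => wlt.
  have : w ^+ 3 <= (109 / 100) ^+ 3 by apply: lerXn2r; rewrite ?nnegrE; lra.
  rewrite -E; lra.
case: (ltP w (31 / 10)) => w31.
  pose e := PAdd (PMul (PC 10000) (PAdd (PPow PX 4) (PC (-1))))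
    (PAdd (PMul (PC (-2200)) (PPow PX 6)) (PMul (PC 3) (PPow PX 12))).
  have := @bernstein_pathP R e 100 109 [:: 160; 200; 230; 310]%ZZ w ltac:(by vm_compute).
  by rewrite !ZtoRE /= => /(_ ltac:(lra) ltac:(lra)); lra.
have w6 : 734 <= w ^+ 6.
  have : (31 / 10) ^+ 6 <= w ^+ 6 by apply: lerXn2r; rewrite ?nnegrE; lra.
  lra.
have w4 : 1 <= w ^+ 4 by rewrite exprn_ege1 //; lra.
have -> : w ^+ (3 * 4) = w ^+ 6 * w ^+ 6 by rewrite -exprD.
have w60 : 0 <= w ^+ 6 by lra.
have := ler_wpM2r w60 w6 => w66.
rewrite (_ : (3 * 2)%N = 6%N) //.
lra.
Qed.

End RademacherMean.

(** * Khinchine's inequality: large fourth moment, two large coefficients *)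

Section Khinchine43.
Variable R : realType.
Implicit Types (l W : seq R) (a u v : R).

Lemma sumpow_cons n a l : sumpow n (a :: l) = a ^+ n + sumpow n l.
Proof. by rewrite /sumpow big_cons. Qed.

(** A large fourth moment of the coefficients means a small fourth moment of
    the signed sum, and interpolation between the moments of orders 2 and 4
    ([pow43_ge24] with [s = 1]) is enough. *)
Lemma khinchine43_large4 l : sumpow 2 l = 1 / 2 -> 1 / 8 <= sumpow 4 l ->
  1 / 2 <= rad l (@pow43 R).
Proof.
move=> l2 l4.
have : rad l (fun x => 4 / 3 * (0 + x) ^+ 2 + - (1 / 3) * (0 + x) ^+ 4) <= rad l (@pow43 R).
  apply: ler_rad => x; rewrite !add0r; have := @pow43_ge24 R 1 x ler01.
  rewrite expr1n; lra.
rewrite radD !radZ rad_sqr rad_pow4 l2; lra.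
Qed.

Lemma rad2_pow43 u v W : rad [:: u, v & W] (@pow43 R) =
  (rad W (fun x => pow43 ((u + v) + x)) + rad W (fun x => pow43 ((u - v) + x))) / 2.
Proof.
rewrite /=.
have -> : rad W (fun x => pow43 (x - v - u)) = rad W (fun x => pow43 ((u + v) + x)).
  by rewrite -rad_opp; apply: eq_rad => x; rewrite -pow43N; congr pow43; ring.
have -> : rad W (fun x => pow43 (x + v - u)) = rad W (fun x => pow43 ((u - v) + x)).
  by rewrite -rad_opp; apply: eq_rad => x; rewrite -pow43N; congr pow43; ring.
have -> : rad W (fun x => pow43 (x + v + u)) = rad W (fun x => pow43 ((u + v) + x)).
  by apply: eq_rad => x; congr pow43; ring.
have -> : rad W (fun x => pow43 (x - v + u)) = rad W (fun x => pow43 ((u - v) + x)).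
  by apply: eq_rad => x; congr pow43; ring.
lra.
Qed.

(** The gain of [pow43_gain] for a sum with one dominating term [v ^+ 3]; pairing
    opposite signs of the remainder removes the odd terms. *)
Lemma rad_pow43_gain v W : 0 < v ->
  v ^+ 4 + 22 / 100 * sumpow 2 W / v ^+ 2
    - 9 / 10 / 1000 * sumpow 2 W ^+ 2 / v ^+ 8 <=
  rad W (fun x => pow43 (v ^+ 3 + x)).
Proof.
move=> v0; have v30 : v ^+ 3 != 0 by rewrite expf_neq0 // gt_eqF.
have -> : rad W (fun x => pow43 (v ^+ 3 + x)) =
    rad W (fun x => v ^+ 4 * ((pow43 (1 + x / v ^+ 3) + pow43 (1 - x / v ^+ 3)) / 2)).
  have -> : rad W (fun x => v ^+ 4 * ((pow43 (1 + x / v ^+ 3) + pow43 (1 - x / v ^+ 3)) / 2))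
     = rad W (fun x => v ^+ 4 / 2 * pow43 (1 + x / v ^+ 3) + v ^+ 4 / 2 * pow43 (1 - x / v ^+ 3)).
    by apply: eq_rad => x; move: (pow43 _) (pow43 _) => A B; field.
  rewrite radD !radZ.
  have -> : rad W (fun x => pow43 (1 - x / v ^+ 3)) = rad W (fun x => pow43 (1 + x / v ^+ 3)).
    by rewrite -rad_opp; apply: eq_rad => x; congr pow43; ring.
  have -> : rad W (fun x => pow43 (v ^+ 3 + x)) = v ^+ 4 * rad W (fun x => pow43 (1 + x / v ^+ 3)).
    rewrite -radZ; apply: eq_rad => x; rewrite -(pow43_cube (ltW v0)) -pow43M.
    by congr pow43; rewrite mulrDr mulr1 mulrC mulfVK.
  lra.
have h : rad W (fun x => v ^+ 4 + (22 / 100 / v ^+ 2 * (0 + x) ^+ 2 + - (3 / 10 / 1000 / v ^+ 8) * (0 + x) ^+ 4))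
    <= rad W (fun x => v ^+ 4 * ((pow43 (1 + x / v ^+ 3) + pow43 (1 - x / v ^+ 3)) / 2)).
  apply: ler_rad => x; rewrite !add0r.
  have := ler_wpM2l (exprn_ge0 4 (ltW v0)) (pow43_gain (x / v ^+ 3)).
  apply: le_trans; rewrite le_eqVlt; apply/orP; left; apply/eqP.
  by field; rewrite gt_eqF.
apply: le_trans h; rewrite radD rad_cst radD !radZ rad_sqr.
have := @rad_pow4_le R W 0; rewrite expr0n /= !add0r.
set m := rad W _ => m4.
have c0 : 0 <= 3 / 10 / 1000 / v ^+ 8 by apply: divr_ge0; [lra | apply: exprn_ge0; exact: ltW].
have := ler_wpM2l c0 m4.
have -> : 3 / 10 / 1000 / v ^+ 8 * (3 * sumpow 2 W ^+ 2) = 9 / 10 / 1000 * sumpow 2 W ^+ 2 / v ^+ 8.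
  by field; rewrite gt_eqF.
have -> : 22 / 100 / v ^+ 2 * sumpow 2 W = 22 / 100 * sumpow 2 W / v ^+ 2.
  by field; rewrite gt_eqF.
lra.
Qed.

(** When [u] and [v] have equal signs, [u + v] dominates the sum and
    [rad_pow43_gain] applies.  When they have opposite signs, the sum is small and
    [pow43_ge24] applies with a parameter [s] slightly above 1. *)
Lemma khinchine43_two u v W : 0 <= u -> 0 <= v ->
  sumpow 2 [:: u, v & W] = 1 / 2 -> 78 / 100 <= u + v ->
  1 / 2 <= rad [:: u, v & W] (@pow43 R).
Proof.
move=> u0 v0; rewrite !sumpow_cons => l2 uv; rewrite rad2_pow43.
have r0 := sumpow_ge0 W (isT : ~~ odd 2).
set r := sumpow 2 W in l2 r0 *.
have s0 : 0 <= u + v by lra.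
have [w w0 E] := cube_root s0.
have d2 := sqr_ge0 (u - v).
(* X0 = (u - v) ^+ 2 / 2 + r, by the normalization of the square sum *)
pose X0 : R := (1 - (u + v) ^+ 2) / 2.
have X : (u - v) ^+ 2 + r = 2 * X0 - r by rewrite /X0; rewrite !expr2 in l2 *; lra.
have rX0 : r <= X0.
  by move: X d2; rewrite /X0; move: ((u - v) ^+ 2) ((u + v) ^+ 2) => D S; lra.
have X06 : X0 <= 196 / 1000.
  rewrite /X0; have : (78 / 100) ^+ 2 <= (u + v) ^+ 2.
    by apply: lerXn2r; rewrite ?nnegrE //; clear -u; lra.
  by clear -u; lra.
have w92 : 92 / 100 <= w.
  rewrite leNgt; apply/negP => wl.
  have : w ^+ 3 <= (92 / 100) ^+ 3.
    by apply: lerXn2r; rewrite ?nnegrE ?(ltW wl) //; clear -u; lra.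
  by rewrite -E; clear -R uv; lra.
have w1 : w <= 1.
  rewrite leNgt; apply/negP => wl; have : 1 < w ^+ 3 by rewrite exprn_egt1.
  rewrite -E => s1; have : 1 < (u + v) ^+ 2 by rewrite exprn_egt1.
  by rewrite /X0 in rX0; lra.
have X0E : X0 = (1 - w ^+ 6) / 2 by rewrite /X0 E -exprM.
have wp : 0 < w by clear -R w92; lra.
have w6 : 6 / 10 <= w ^+ 6.
  have : (92 / 100) ^+ 6 <= w ^+ 6.
    by apply: lerXn2r; rewrite ?nnegrE //; clear -u; lra.
  by clear -u; lra.
have rr : r ^+ 2 <= X0 * r by rewrite expr2 ler_wpM2r.
have iw : 1 <= (w ^+ 2)^-1 /\ (w ^+ 2)^-1 <= 12 / 10.
  have w2 : w ^+ 2 <= 1 by rewrite exprn_ile1.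
  have w22 : 10 / 12 <= w ^+ 2 by rewrite expr2; clear -R w92; nra.
  split; first by rewrite invf_ge1 ?exprn_gt0.
  rewrite -[X in _ <= X]invrK lef_pV2 ?posrE ?exprn_gt0 ?invr_gt0 //; clear -R w22; lra.
(* the quartic term of the gain lowers the coefficient 22/100 of the quadratic
   one by at most 5/10000 *)
have loss : 9 / 10 / 1000 * r ^+ 2 / w ^+ 8 <= 5 / 10 / 1000 * r / w ^+ 2.
  have -> : 9 / 10 / 1000 * r ^+ 2 / w ^+ 8 = (9 / 10 / 1000 * r / w ^+ 6) * r / w ^+ 2.
    by field; rewrite gt_eqF.
  rewrite ler_wpM2r ?invr_ge0 ?exprn_ge0 // ler_wpM2r //.
  by rewrite ler_pdivrMr ?exprn_gt0 //; clear -R rX0 X06 r0 w6; lra.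
(* opposite signs; 23/20 is close to the best Young parameter *)
have low : (4 * (23 / 20) * (2 * X0 - r) - 3 * (23 / 20) ^+ 4 * (2 * X0 - r) ^+ 2) / 3
    <= rad W (fun x => pow43 ((u - v) + x)).
  have : rad W (fun x => 4 / 3 * (23 / 20) * ((u - v) + x) ^+ 2
      + - ((23 / 20) ^+ 4 / 3) * ((u - v) + x) ^+ 4) <= rad W (fun x => pow43 ((u - v) + x)).
    have s23 : 0 <= 23 / 20 :> R by clear -u; lra.
    by apply: ler_rad => x; have := pow43_ge24 ((u - v) + x) s23; clear -u; lra.
  apply: le_trans; rewrite radD !radZ rad_sqr -/r X.
  by have := rad_pow4_le W (u - v); rewrite -/r X; clear -u; lra.
(* Both estimates together are bounded below by a decreasing affine function of
   r; this is its value at the worst case r = X0, that is u = v. *)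
have lin : 1 <= w ^+ 4 + 2195 / 5000 / 2 * X0 / w ^+ 2
    + (4 / 3 * (23 / 20) * X0 - (23 / 20) ^+ 4 * X0 ^+ 2).
  case: (ltP w 1) => w1'; last first.
    have -> : w = 1 by apply/le_anti; rewrite w1 w1'.
    by rewrite X0E (_ : w = 1); [rewrite !expr1n; clear -u; lra | apply/le_anti; rewrite w1 w1'].
  pose x0 := PAdd (PC 1) (PMul (PC (-1)) (PPow PX 6)).
  pose e := PAdd (PMul (PC 1920000) (PPow PX 6)) (PAdd (PMul (PC 210720) x0)
   (PMul (PPow PX 2) (PAdd (PMul (PC 1472000) x0) (PAdd (PMul (PC (-839523)) (PPow x0 2)) (PC (-1920000)))))).
  have := @bernstein_pathP R e 100 92 [:: 96; 100]%ZZ w ltac:(by vm_compute).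
  rewrite !ZtoRE /= => /(_ ltac:(clear -R w92; lra) ltac:(clear -R w1'; lra)) q0.
  have w20 : 0 < w ^+ 2 by rewrite exprn_gt0.
  rewrite -subr_ge0 -(pmulr_lge0 _ w20).
  have -> : (w ^+ 4 + 2195 / 5000 / 2 * X0 / w ^+ 2 +
     (4 / 3 * (23 / 20) * X0 - (23 / 20) ^+ 4 * X0 ^+ 2) - 1) * w ^+ 2 =
     w ^+ 6 + 2195 / 5000 / 2 * X0 + w ^+ 2 * (4 / 3 * (23 / 20) * X0 - (23 / 20) ^+ 4 * X0 ^+ 2 - 1).
    by field; rewrite gt_eqF.
  by rewrite X0E; clear -R q0; lra.
have high := @rad_pow43_gain w W wp; rewrite -E -/r in high.
have [i1 i2] := iw; set i := (w ^+ 2)^-1 in i1 i2 high loss lin *.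
(* the slope in r is negative *)
have : 0 <= (X0 - r) * (23 / 15 - 2195 / 5000 / 2 * i - 3 * (23 / 20) ^+ 4 * X0).
  by apply: mulr_ge0; [clear -R rX0 | clear -R i2 X06]; lra.
by move: (rad W _) (rad W _) high low => A B high low prod; clear -R high low prod loss lin X rr; lra.
Qed.

End Khinchine43.

(** * Khinchine's inequality through products of cosines *)

Section CosineProducts.
Variable R : realType.
Implicit Types (l W : seq R) (a u v : R).

Lemma cos_pi_ge0 a : - (1 / 2) <= a -> a <= 1 / 2 -> 0 <= cos (pi * a).
Proof.
move=> a1 a2; apply: cos_ge0_pihalf; have := ler_wpM2l (pi_ge0 R) a1.
by have := ler_wpM2l (pi_ge0 R) a2; move=> h1 h2; apply/andP; split; lra.
Qed.

Definition cosprod (k : R) l : R := \prod_(a <- l) cos (k * (pi * a)).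

Lemma cosprod_cons k a l : cosprod k (a :: l) = cos (k * (pi * a)) * cosprod k l.
Proof. by rewrite /cosprod big_cons. Qed.

Lemma rad_cos_test l : sumpow 2 l = 1 / 2 ->
  rad l (@cos_test R) = 1113 / 2 + 84 * sumpow 4 l
    - 157 * cosprod 1 l - 27 * cosprod 2 l - 2 * cosprod 3 l.
Proof.
move=> l2.
have radc k : rad l (fun x => cos (k * (pi * x))) = cosprod k l.
  have := rad_cos l (k * pi) 0; rewrite mulr0 cos0 mul1r /cosprod => h.
  under [RHS]eq_bigr do rewrite mulrA.
  by rewrite -h; apply: eq_rad => x; rewrite add0r mulrA.
rewrite -!radc.
rewrite (@eq_rad _ _ l _ (fun x => (804 * (0 + x) ^+ 2 + - 42 * (0 + x) ^+ 4) +
  (186 + (- 157 * cos (1 * (pi * x)) + (- 27 * cos (2 * (pi * x)) + - 2 * cos (3 * (pi * x))))))); last first.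
  by move=> x; rewrite /cos_test add0r mul1r; ring.
rewrite radD radD radZ radZ radD rad_cst radD radZ radD radZ radZ rad_sqr rad_pow4 l2.
lra.
Qed.

(** The cosine test reduces Khinchine's inequality to an upper bound on three
    products of cosines. *)
Lemma khinchine43_cos l : sumpow 2 l = 1 / 2 ->
  157 * cosprod 1 l + 27 * cosprod 2 l + 2 * cosprod 3 l <= 33 / 2 + 84 * sumpow 4 l ->
  1 / 2 <= rad l (@pow43 R).
Proof.
move=> l2 h; have := ler_rad l (@cos_test_le R); rewrite radZ rad_cos_test //; lra.
Qed.

Lemma norm_cosprod_le1 k l : `|cosprod k l| <= 1.
Proof.
elim: l => [|a l IH]; first by rewrite /cosprod big_nil normr1.
by rewrite cosprod_cons normrM mulr_ile1 // cos_max.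
Qed.

Lemma norm_cosprod_exp k (b c : R) l :
  (forall a, a \in l -> `|cos (k * (pi * a))| <= expR (- (b * a ^+ 2 + c * a ^+ 4))) ->
  `|cosprod k l| <= expR (- (b * sumpow 2 l + c * sumpow 4 l)).
Proof.
elim: l => [|a l IH] h.
  by rewrite /cosprod /sumpow !big_nil normr1 !mulr0 addr0 oppr0 expR0.
rewrite cosprod_cons normrM !sumpow_cons.
have -> : - (b * (a ^+ 2 + sumpow 2 l) + c * (a ^+ 4 + sumpow 4 l)) =
  - (b * a ^+ 2 + c * a ^+ 4) + - (b * sumpow 2 l + c * sumpow 4 l) by ring.
rewrite expRD ler_pM // ?h ?mem_head // IH // => x xl.
by apply: h; rewrite inE xl orbT.
Qed.

(** On [[0, 1/2]], the modulus of [cos (2 pi a)] is governed by the distance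
    of [a] to [0] or to [1/2]. *)
Lemma norm_cos2_le (t a : R) : 0 <= a -> a <= 1 / 2 ->
  (a <= 1 / 4 -> t <= 196 / 10 * a ^+ 2) ->
  (1 / 4 <= a -> t <= 49 / 10 * (1 - 2 * a) ^+ 2) ->
  `|cos (2 * (pi * a))| <= expR (- t).
Proof.
move=> a0 a2 h1 h2; have [pi2l pi2u] := pi2_bounds R.
case: (leP a (1 / 4)) => a4.
  have c0 : 0 <= cos (2 * (pi * a)) by rewrite mulrCA; apply: cos_pi_ge0; lra.
  rewrite ger0_norm //.
  have a16 : a ^+ 2 <= 1 / 16 by rewrite expr2; nra.
  apply: le_trans (cos_le_expR _) _; rewrite !exprMn.
    have := ler_wpM2r (sqr_ge0 a) pi2u; lra.
  rewrite ler_expR lerN2; apply: le_trans (h1 a4) _.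
  have := ler_wpM2r (sqr_ge0 a) pi2l; lra.
have E : cos (2 * (pi * a)) = - cos (pi * (1 - 2 * a)).
  have -> : pi * (1 - 2 * a) = - (2 * (pi * a)) + pi by ring.
  by rewrite cosDpi cosN opprK.
have c0 : 0 <= cos (pi * (1 - 2 * a)) by apply: cos_pi_ge0; lra.
rewrite E normrN ger0_norm //.
have b0 : 0 <= 1 - 2 * a by lra.
have b16 : (1 - 2 * a) ^+ 2 <= 1 / 4 by rewrite expr2; nra.
apply: le_trans (cos_le_expR _) _; rewrite !exprMn.
  have := ler_wpM2r (sqr_ge0 (1 - 2 * a)) pi2u; lra.
rewrite ler_expR lerN2; apply: le_trans (h2 (ltW a4)) _.
have := ler_wpM2r (sqr_ge0 (1 - 2 * a)) pi2l; lra.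
Qed.

(** Numerical values of the exponential are obtained from the quadratic bound at
    a small argument, raised to a power. *)
Lemma expRN_le_pow n (y b : R) : 0 <= y ->
  1 - y + y ^+ 2 / 2 <= b -> expR (- (n%:R * y)) <= b ^+ n.
Proof.
move=> y0 yb; rewrite -mulrN expRM_natl lerXn2r ?nnegrE ?expR_ge0 //.
  by apply: le_trans (expR_ge0 (- y)) (le_trans (expRN_le2 y0) yb).
exact: le_trans (expRN_le2 y0) yb.
Qed.

Lemma sumpow4_le l c : (forall a, a \in l -> 0 <= a <= c) ->
  sumpow 4 l <= c ^+ 2 * sumpow 2 l.
Proof.
move=> h; rewrite /sumpow mulr_sumr big_seq [leRHS]big_seq; apply: ler_sum => a al.
have -> : a ^+ 4 = a ^+ 2 * a ^+ 2 by ring.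
rewrite ler_wpM2r ?sqr_ge0 //; have /andP[a0 ac] := h a al.
by rewrite lerXn2r ?nnegrE // (le_trans a0).
Qed.

(** The constant 5 is valid up to [a = 33/100], although [cos (2 pi a)] changes
    sign at [1/4]. *)
Lemma cosprod2_small W : (forall a, a \in W -> 0 <= a <= 33 / 100) ->
  `|cosprod 2 W| <= expR (- (5 * sumpow 2 W)).
Proof.
move=> hW; have := @norm_cosprod_exp 2 5 0 W; rewrite mul0r addr0; apply => a aW.
have /andP[a0 a33] := hW a aW; rewrite mul0r addr0.
apply: norm_cos2_le => //; [lra | by have := sqr_ge0 a; lra |].
move=> a4; have := sqr_ge0 (a - 33 / 100).
have -> : (a - 33 / 100) ^+ 2 = a ^+ 2 - 66 / 100 * a + (33 / 100) ^+ 2 by field.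
have -> : (1 - 2 * a) ^+ 2 = 1 - 4 * a + 4 * a ^+ 2 by ring.
by clear -a4 a33; lra.
Qed.

Lemma cosprod1_ge0 W : (forall a, a \in W -> 0 <= a <= 33 / 100) ->
  0 <= cosprod 1 W.
Proof.
move=> hW; rewrite /cosprod big_seq; apply: prodr_ge0 => a /hW /andP[a0 a1].
by rewrite mul1r; apply: cos_pi_ge0; lra.
Qed.

Lemma cosprod1_small W : (forall a, a \in W -> 0 <= a <= 33 / 100) ->
  cosprod 1 W <= expR (- (49 / 10 * sumpow 2 W)).
Proof.
move=> hW; apply: ler_normlW.
have := @norm_cosprod_exp 1 (49 / 10) 0 W; rewrite mul0r addr0; apply => a aW.
have /andP[a0 a33] := hW a aW; rewrite mul0r addr0 mul1r; clear aW hW.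
rewrite ger0_norm; last by apply: cos_pi_ge0; lra.
have a11 : a ^+ 2 <= 11 / 100 by rewrite expr2; nra.
have [pi2l pi2u] := pi2_bounds R.
have l := ler_wpM2r (sqr_ge0 a) pi2l; have h := ler_wpM2r (sqr_ge0 a) pi2u.
apply: le_trans (cos_le_expR _) _; rewrite !exprMn; first by clear -h a11; lra.
by rewrite ler_expR lerN2; clear -l; lra.
Qed.

Lemma cos_pi_half u : 45 / 100 <= u -> u <= 1 / 2 ->
  0 <= cos (1 * (pi * u)) <= 1575 / 10 / 1000.
Proof.
move=> u45 u12; rewrite mul1r cos_pi_ge0 //=; last by lra.
have p315 : pi <= 315 / 100 :> R.
  rewrite leNgt; apply/negP => h; have [_ pi2u] := pi2_bounds R.
  have : (315 / 100) ^+ 2 < pi ^+ 2 :> R by rewrite expr2; nra.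
  by move: pi2u; clear; lra.
have -> : cos (pi * u) = sin (pi * (1 / 2 - u)).
  by rewrite -cosBpihalf -cosN; congr cos; lra.
have b0 : 0 <= 1 / 2 - u by lra.
have b1 : 1 / 2 - u <= 5 / 100 by lra.
have b2 := ler_pM (pi_ge0 R) b0 p315 b1.
have b3 : 0 <= pi * (1 / 2 - u) by rewrite mulr_ge0 ?pi_ge0.
have := sin_le1 b3; move: b2; clear; lra.
Qed.

(** One dominating coefficient.  The others have square sum at least 1/4 if
    [u <= 1/2], which makes the products over [W] small, while [cos (pi u)] is
    small because [u] is close to [1/2].  If [1/2 < u], then [cos (pi u)] is
    nonpositive and the first product does not count. *)
Lemma khinchine43_one u W : 45 / 100 <= u ->
  (forall a, a \in W -> 0 <= a <= 33 / 100) ->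
  sumpow 2 (u :: W) = 1 / 2 -> sumpow 4 (u :: W) <= 1 / 8 ->
  1 / 2 <= rad (u :: W) (@pow43 R).
Proof.
move=> u45 hW; move=> l2 l4; apply: khinchine43_cos => //.
move: l2 l4; rewrite !sumpow_cons => l2 l4.
have W4 := sumpow_ge0 W (isT : ~~ odd 4); have W2 := sumpow_ge0 W (isT : ~~ odd 2).
have P3 := ler_normlW (norm_cosprod_le1 3 (u :: W)).
have P2 : cosprod 2 (u :: W) <= expR (- (5 * sumpow 2 W)).
  apply: ler_normlW; rewrite cosprod_cons normrM -[leRHS]mul1r.
  by rewrite ler_pM ?cos_max // cosprod2_small.
have cW0 := cosprod1_ge0 hW; have PW := cosprod1_small hW.
have cE := cosprod_cons 1 u W.
move: (cosprod 1 W) (cosprod 1 (u :: W)) (cosprod 2 _) (cosprod 3 _) cW0 PW cE P2 P3.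
move: (sumpow 2 W) (sumpow 4 W) l2 l4 W2 W4 => S2 S4 l2 l4 W2 W4 Q1 C1 C2 C3.
move=> cW0 PW C1E P2 P3; clear hW W.
have uW : u ^+ 4 = (u ^+ 2) ^+ 2 by ring.
have u2 : (45 / 100) ^+ 2 <= u ^+ 2.
  by apply: lerXn2r; rewrite ?nnegrE //; clear -u45; lra.
have u4 : 4 / 100 <= u ^+ 4 by rewrite uW; clear -u2; nra.
case: (ltP (1 / 2) u) => u12.
  have c0 : cos (1 * (pi * u)) <= 0.
    have -> : 1 * (pi * u) = pi * (u - 1) + pi by ring.
    have u1 : u <= 1 by clear -l2 W2; nra.
    by rewrite cosDpi oppr_le0; apply: cos_pi_ge0; clear -u1 u12; lra.
  have P1 : C1 <= 0 by rewrite C1E mulr_le0_ge0.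
  have u52 : u ^+ 2 <= 354 / 1000.
    rewrite leNgt; apply/negP => h.
    have : 1 / 8 < (u ^+ 2) ^+ 2 by rewrite [ltRHS]expr2; clear -h; nra.
    by rewrite -uW; clear -l4 W4; lra.
  have uu : 1 / 16 <= u ^+ 4.
    rewrite uW; have : 1 / 4 <= u ^+ 2 by rewrite expr2; clear -u12; nra.
    by move: (u ^+ 2) => z; rewrite expr2; clear; nra.
  have e1 : expR (- (5 * S2)) <= expR (- (8%:R * (73 / 800))).
    by rewrite ler_expR; clear -l2 u52; lra.
  have e2 : expR (- (8%:R * (73 / 800))) <= (92 / 100) ^+ 8 :> R.
    by apply: expRN_le_pow; clear; lra.
  by move: (expR _) (expR _) e1 e2 P2 => x y; clear -P1 P3 uu W4; lra.
have W25 : 1 / 4 <= S2.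
  have : u ^+ 2 <= 1 / 4 by rewrite expr2; clear -u12 u45; nra.
  by clear -l2; lra.
have e1 : expR (- (5 * S2)) <= expR (- (8%:R * (125 / 800))).
  by rewrite ler_expR; clear -W25; lra.
have e2 : expR (- (8%:R * (125 / 800))) <= (856 / 1000) ^+ 8 :> R.
  by apply: expRN_le_pow; clear; lra.
have /andP[c00 c1] := cos_pi_half u45 u12.
have e3 : expR (- (49 / 10 * S2)) <= expR (- (8%:R * (49 / 320))).
  by rewrite ler_expR; clear -W25; lra.
have e4 : expR (- (8%:R * (49 / 320))) <= (4293 / 5 / 1000) ^+ 8 :> R.
  by apply: expRN_le_pow; clear; lra.
have P1 : C1 <= 1575 / 10 / 1000 * (1 / 3).
  rewrite C1E; apply: ler_pM => //; apply: le_trans PW (le_trans e3 (le_trans e4 _)).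
  by clear; lra.
by move: (expR _) (expR _) e1 e2 P2 => x y; clear -P1 P3 u4 W4; lra.
Qed.

End CosineProducts.

(** * Khinchine's inequality: all coefficients small *)

Section SpreadOut.
Variable R : realType.
Implicit Types (l W : seq R) (a u v : R).

Lemma expR_chord (a b t : R) : 0 <= t -> t <= 1 ->
  expR ((1 - t) * a + t * b) <= (1 - t) * expR a + t * expR b.
Proof.
move=> t0 t1.
have i01 : Itv.spec (@Itv.num_sem R) (Itv.Real `[0%Z, 1%Z]) t.
  by rewrite /= /Itv.num_sem num_real /= in_itv /= t0 t1.
have := @convex_expR R (Itv.mk i01) b a.
by rewrite !convRE /= /unstable.onem addrC [X in _ -> _ <= X]addrC.
Qed.

(** The quartic correction weakens the Gaussian bound because the modulus of
    [cos (2 pi a)] is close to 1 again near [a = 45/100]. *)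
Lemma spread_cos2 a : 0 <= a -> a <= 45 / 100 ->
  `|cos (2 * (pi * a))| <= expR (- (86 / 10 * a ^+ 2 + - (465 / 10) * a ^+ 4)).
Proof.
move=> a0 a45; apply: norm_cos2_le; [exact: a0|lra| |] => a4.
  have := sqr_ge0 a; have := exprn_ge0 4 a0; lra.
pose e := PAdd (PMul (PC 49) (PPow (PAdd (PC 1) (PMul (PC (-2)) PX)) 2))
  (PAdd (PMul (PC (-86)) (PPow PX 2)) (PMul (PC 465) (PPow PX 4))).
have := @bernstein_pathP R e 100 25 [:: 32; 36; 39; 42; 46]%ZZ a ltac:(by vm_compute).
by rewrite !ZtoRE /= => /(_ ltac:(lra) ltac:(lra)); lra.
Qed.

Lemma spread_cos1 a : 0 <= a -> a <= 45 / 100 ->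
  `|cos (1 * (pi * a))| <= expR (- (49 / 10 * a ^+ 2 + 686 / 100 * a ^+ 4)).
Proof.
move=> a0 a45; rewrite mul1r ger0_norm; last by apply: cos_pi_ge0; lra.
have a2 : a ^+ 2 <= 2025 / 1000 / 10 by rewrite expr2; nra.
have [pi2l pi2u] := pi2_bounds R.
have h1 := ler_wpM2r (sqr_ge0 a) pi2l.
have a20 := sqr_ge0 a.
have h2 : (98 / 10) ^+ 2 * (a ^+ 2) ^+ 2 <= (pi ^+ 2 * a ^+ 2) ^+ 2.
  rewrite -exprMn; apply: lerXn2r; rewrite ?nnegrE //.
    by apply: mulr_ge0 => //; clear; lra.
  by apply: mulr_ge0; exact: sqr_ge0.
apply: le_trans (cos_le_expR4 _) _; rewrite !exprMn.
  by have := ler_wpM2r (sqr_ge0 a) pi2u; clear -a2; lra.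
rewrite ler_expR lerN2.
have -> : a ^+ 4 = (a ^+ 2) ^+ 2 by ring.
by rewrite exprMn in h2; clear -h1 h2; lra.
Qed.

Lemma expRN_double (y b c : R) : expR (- y) <= b -> b ^+ 2 <= c ->
  expR (- (2 * y)) <= c.
Proof.
move=> yb bc; rewrite -mulrN expRM_natl; apply: le_trans bc.
have e0 := expR_ge0 (- y).
by apply: lerXn2r; rewrite ?nnegrE //; apply: le_trans yb.
Qed.

(* The values at the fourth moments 0 and 761/10000 of the exponential bounds on
   the products of [cos (pi a)] and of [cos (2 pi a)]. *)
Lemma exp_cos1_spread0 : expR (- (32%:R * (245 / 3200))) <= 87 / 1000 :> R.
Proof.
have e0 : expR (- (245 / 3200)) <= 579 / 625 :> R.
  by apply: le_trans (expRN_le2 _) _; lra.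
have n1 : (579 / 625) ^+ 2 <= 8583 / 1000 / 10 :> R by clear; lra.
have n2 : (8583 / 1000 / 10) ^+ 2 <= 7367 / 1000 / 10 :> R by clear; lra.
have n3 : (7367 / 1000 / 10) ^+ 2 <= 1357 / 2500 :> R by clear; lra.
have n4 : (1357 / 2500) ^+ 2 <= 2947 / 1000 / 10 :> R by clear; lra.
have n5 : (2947 / 1000 / 10) ^+ 2 <= 87 / 1000 :> R by clear; lra.
apply: le_trans (expRN_double (expRN_double (expRN_double (expRN_double (expRN_double e0 n1) n2) n3) n4) n5).
by rewrite ler_expR; clear; lra.
Qed.

Lemma exp_cos1_spread1 : expR (- (32%:R * (743 / 8 / 1000))) <= 519 / 1000 / 10 :> R.
Proof.
have e0 : expR (- (743 / 8 / 1000)) <= 1823 / 2000 :> R.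
  by apply: le_trans (expRN_le2 _) _; lra.
have n1 : (1823 / 2000) ^+ 2 <= 8309 / 1000 / 10 :> R by clear; lra.
have n2 : (8309 / 1000 / 10) ^+ 2 <= 863 / 1250 :> R by clear; lra.
have n3 : (863 / 1250) ^+ 2 <= 4767 / 1000 / 10 :> R by clear; lra.
have n4 : (4767 / 1000 / 10) ^+ 2 <= 2273 / 1000 / 10 :> R by clear; lra.
have n5 : (2273 / 1000 / 10) ^+ 2 <= 519 / 1000 / 10 :> R by clear; lra.
apply: le_trans (expRN_double (expRN_double (expRN_double (expRN_double (expRN_double e0 n1) n2) n3) n4) n5).
by rewrite ler_expR; clear; lra.
Qed.

Lemma exp_cos2_spread0 : expR (- (43 / 10)) <= 3 / 200 :> R.
Proof.
have e0 : expR (- (43 / 320)) <= 7 / 8 :> R.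
  by apply: le_trans (expRN_le2 _) _; lra.
have n1 : (7 / 8) ^+ 2 <= 383 / 500 :> R by clear; lra.
have n2 : (383 / 500) ^+ 2 <= 587 / 1000 :> R by clear; lra.
have n3 : (587 / 1000) ^+ 2 <= 69 / 200 :> R by clear; lra.
have n4 : (69 / 200) ^+ 2 <= 239 / 2000 :> R by clear; lra.
have n5 : (239 / 2000) ^+ 2 <= 3 / 200 :> R by clear; lra.
apply: le_trans (expRN_double (expRN_double (expRN_double (expRN_double (expRN_double e0 n1) n2) n3) n4) n5).
by rewrite ler_expR; clear; lra.
Qed.

Lemma exp_cos2_spread1 : expR (- (8%:R * (2379 / 25 / 1000))) <= 469 / 1000 :> R.
Proof.
have e0 : expR (- (2379 / 25 / 1000)) <= 1819 / 2000 :> R.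
  by apply: le_trans (expRN_le2 _) _; lra.
have n1 : (1819 / 2000) ^+ 2 <= 517 / 625 :> R by clear; lra.
have n2 : (517 / 625) ^+ 2 <= 6843 / 1000 / 10 :> R by clear; lra.
have n3 : (6843 / 1000 / 10) ^+ 2 <= 469 / 1000 :> R by clear; lra.
apply: le_trans (expRN_double (expRN_double (expRN_double e0 n1) n2) n3).
by rewrite ler_expR; clear; lra.
Qed.

(** All coefficients are small: the bounds on the first two products are
    exponentials of affine functions of the fourth moment [M].  They lie below
    their chords on the range of [M], and the inequality is affine in [M]
    afterwards. *)
Lemma khinchine43_spread l :
  (forall a, a \in l -> 0 <= a <= 45 / 100) ->
  sumpow 2 l = 1 / 2 -> sumpow 4 l <= 761 / 1000 / 10 ->
  1 / 2 <= rad l (@pow43 R).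
Proof.
move=> hl l2 l4; apply: khinchine43_cos => //.
have M0 := sumpow_ge0 l (isT : ~~ odd 4).
have P3 := ler_normlW (norm_cosprod_le1 3 l).
have P2 : cosprod 2 l <= expR (- (86 / 10 * sumpow 2 l + - (465 / 10) * sumpow 4 l)).
  apply/ler_normlW/norm_cosprod_exp => a /hl /andP[]; exact: spread_cos2.
have P1 : cosprod 1 l <= expR (- (49 / 10 * sumpow 2 l + 686 / 100 * sumpow 4 l)).
  apply/ler_normlW/norm_cosprod_exp => a /hl /andP[]; exact: spread_cos1.
rewrite l2 in P1 P2; move: (sumpow 4 l) l4 M0 P1 P2 => M l4 M0 P1 P2.
move: (cosprod 1 l) (cosprod 2 l) (cosprod 3 l) P1 P2 P3 => C1 C2 C3 P1 P2 P3.
clear hl l2 l.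
(* t is the position of M in its range [0, c] *)
pose c : R := 761 / 1000 / 10.
have c0 : 0 < c by rewrite /c; clear; lra.
pose t := M / c.
have t0 : 0 <= t by rewrite divr_ge0 // ltW.
have t1 : t <= 1 by rewrite ler_pdivrMr // mul1r.
have t1' : 0 <= 1 - t by rewrite subr_ge0.
have ME : M = t * c by rewrite /t divfK // gt_eqF.
clearbody t; rewrite {}ME /c in P1 P2 *; clear l4 M0 c0 c M.
have e1 := expR_chord (- (32%:R * (245 / 3200))) (- (32%:R * (743 / 8 / 1000))) t0 t1.
have e2 := expR_chord (- (43 / 10)) (- (8%:R * (2379 / 25 / 1000))) t0 t1.
have {e1 P1}P1 : C1 <= (1 - t) * (87 / 1000) + t * (519 / 1000 / 10).
  apply: le_trans P1 _; apply: le_trans (lerD (ler_wpM2l t1' exp_cos1_spread0) (ler_wpM2l t0 exp_cos1_spread1)).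
  by apply: le_trans e1; rewrite ler_expR; clear -t0; lra.
have {e2 P2}P2 : C2 <= (1 - t) * (3 / 200) + t * (469 / 1000).
  apply: le_trans P2 _; apply: le_trans (lerD (ler_wpM2l t1' exp_cos2_spread0) (ler_wpM2l t0 exp_cos2_spread1)).
  by apply: le_trans e2; rewrite ler_expR; clear -t0; lra.
by clear -t0 t1 P1 P2 P3; lra.
Qed.

End SpreadOut.

(** * The sharp Khinchine inequality with exponent 4/3 *)

Section KhinchineAssembled.
Variable R : realType.
Implicit Types (l W : seq R) (a u v : R).

(* If the largest coefficient u lies between 39/100 and 45/100, the others are
   at most 78/100 - u, since the sum of the two largest is below 78/100; this
   bounds the fourth moment by 761/10000. *)
Let khinchine43_sorted u v W : sorted >=%R [:: u, v & W] ->
  (forall a, a \in [:: u, v & W] -> 0 <= a) ->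
  sumpow 2 [:: u, v & W] = 1 / 2 -> 1 / 2 <= rad [:: u, v & W] (@pow43 R).
Proof.
move=> srt pos l2.
have u0 : 0 <= u by apply: pos; rewrite mem_head.
have v0 : 0 <= v by apply: pos; rewrite !inE eqxx orbT.
have [vu vW] : v <= u /\ forall a, a \in v :: W -> a <= v.
  move: srt; rewrite /= => /andP[vu p]; split=> // a; rewrite inE => /predU1P[->//|aW].
  have := order_path_min (rev_trans le_trans) p.
  by move=> /allP /(_ a aW).
have [l4|l4] := leP (1 / 8) (sumpow 4 [:: u, v & W]); first exact: khinchine43_large4.
have [uv|uv] := leP (78 / 100) (u + v); first exact: khinchine43_two.
have vWa a : a \in v :: W -> 0 <= a by move=> aW; apply: pos; rewrite inE aW orbT.
have [u45|u45] := leP (45 / 100) u.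
  apply: khinchine43_one => // [a aW|]; last exact: ltW.
  by rewrite (vWa _ aW) /=; have := vW a aW; lra.
apply: khinchine43_spread => // [a|].
  rewrite inE => /predU1P[->|aW]; first by rewrite u0 ltW.
  by rewrite (vWa _ aW) /=; have := vW a aW; lra.
have [u39|u39] := leP u (39 / 100).
  apply: le_trans (@sumpow4_le _ _ (39 / 100) _) _ => [a|].
    rewrite inE => /predU1P[->|aW]; first by rewrite u0 u39.
    by rewrite (vWa _ aW) /=; have := vW a aW; lra.
  rewrite l2; lra.
move: l2; rewrite !(sumpow_cons _ u) => l2.
have : sumpow 4 (v :: W) <= (78 / 100 - u) ^+ 2 * sumpow 2 (v :: W).
  apply: sumpow4_le => a aW; by rewrite (vWa _ aW) /=; have := vW a aW; lra.
have -> : sumpow 2 (v :: W) = 1 / 2 - u ^+ 2 by lra.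
pose e := PAdd (PC 1522) (PAdd (PMul (PC (-20000)) (PPow PX 4)) (PMul (PC (-1))
  (PMul (PPow (PAdd (PC 78) (PMul (PC (-100)) PX)) 2) (PAdd (PC 1) (PMul (PC (-2)) (PPow PX 2)))))).
have := @bernstein_pathP R e 100 39 [:: 42; 46]%ZZ u ltac:(by vm_compute).
rewrite !ZtoRE /= => /(_ ltac:(lra) ltac:(lra)) q0 h.
lra.
Qed.

(** The coefficients may be replaced by their moduli, sorted, and completed by
    two zeros so that there are always two largest ones. *)
Theorem khinchine43 l : sumpow 2 l = 1 / 2 -> 1 / 2 <= rad l (@pow43 R).
Proof.
move=> l2; pose l' := sort >=%R [seq `|a| | a <- [:: 0, 0 & l]].
have pl : perm_eq l' [seq `|a| | a <- [:: 0, 0 & l]] by rewrite /l' perm_sort.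
have -> : rad l (@pow43 R) = rad l' (@pow43 R).
  by rewrite (rad_perm _ pl) rad_norm !rad_shift0.
have l2' : sumpow 2 l' = 1 / 2.
  rewrite /sumpow (perm_big _ pl) /= !big_cons big_map normr0 expr0n /= !add0r -l2.
  by apply: eq_bigr => a _; rewrite real_normK ?num_real.
have pos a : a \in l' -> 0 <= a by rewrite (perm_mem pl) => /mapP[b _ ->].
have srt : sorted >=%R l' by apply: sort_sorted => x y; exact: le_total.
have : size l' = (size l).+2 by rewrite size_sort size_map.
move: l' {pl} srt pos l2' => [|u [|v W]] // srt pos l2' _.
exact: khinchine43_sorted.
Qed.

End KhinchineAssembled.

(** * Hoelder's inequality for finite sums *)

Section PowerInequalities.
Variable R : realType.
Implicit Types (x y t : R).

Lemma young_powR t x y : 0 <= t <= 1 -> 0 <= x -> 0 <= y ->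
  x `^ t * y `^ (1 - t) <= t * x + (1 - t) * y.
Proof.
move=> /andP[t0 t1] x0 y0.
have t1' : 0 <= 1 - t by lra.
move: t0; rewrite le_eqVlt => /predU1P[<-|t0].
  by rewrite powRr0 subr0 powRr1 // !mul1r mul0r add0r.
move: t1'; rewrite le_eqVlt => /predU1P[E|t1'].
  by rewrite -E powRr0 mul0r addr0 mulr1 (_ : t = 1) ?powRr1 ?mul1r //; lra.
move: x0; rewrite le_eqVlt => /predU1P[<-|x0].
  by rewrite powR0 ?gt_eqF // mul0r mulr0 add0r mulr_ge0 // ltW.
move: y0; rewrite le_eqVlt => /predU1P[<-|y0].
  by rewrite [X in _ * X]powR0 ?gt_eqF // !mulr0 addr0 mulr_ge0 // ltW.
have E : expR ((1 - t) * ln y + t * ln x) = x `^ t * y `^ (1 - t).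
  by rewrite expRD mulrC (mulrC (1 - t)) (mulrC t) !expRM !lnK ?posrE.
have := @expR_chord R (ln y) (ln x) t (ltW t0) t1.
rewrite E !lnK ?posrE //. by rewrite (addrC (t * x)).
Qed.

(** Young's inequality between [x `^ t] and 1. *)
Lemma bernoulli_powR t x : 1 <= t -> 0 <= x -> 1 + t * (x - 1) <= x `^ t.
Proof.
move=> t1 x0; have t0 : 0 < t by lra.
have := @young_powR t^-1 (x `^ t) 1 _ (powR_ge0 _ _) ler01.
rewrite -powRrM mulfV ?gt_eqF // powRr1 // powR1 mulr1 invr_ge0 ltW //= invf_le1 // t1.
move=> /(_ isT) h; have := ler_wpM2l (ltW t0) h.
rewrite mulrDr mulrA mulfV ?gt_eqF // mul1r mulr1 mulrBr mulr1 mulfV ?gt_eqF //; lra.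
Qed.

Lemma hoelder_sum (I : eqType) (r : seq I) (f g : I -> R) t : 0 <= t <= 1 ->
  (forall i, 0 <= f i) -> (forall i, 0 <= g i) ->
  \sum_(i <- r) f i `^ t * g i `^ (1 - t) <=
  (\sum_(i <- r) f i) `^ t * (\sum_(i <- r) g i) `^ (1 - t).
Proof.
move=> t01 f0 g0; have [t0 t1] := andP t01.
have F0 : 0 <= \sum_(i <- r) f i by apply: sumr_ge0.
have G0 : 0 <= \sum_(i <- r) g i by apply: sumr_ge0.
move: t0; rewrite le_eqVlt => /predU1P[<-|t0].
  by rewrite powRr0 mul1r subr0 powRr1 //; apply: ler_sum => i _; rewrite powRr0 mul1r powRr1.
move: t1; rewrite le_eqVlt => /predU1P[->|t1].
  rewrite subrr powRr0 mulr1 powRr1 //; apply: ler_sum => i _; by rewrite powRr0 mulr1 powRr1.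
have t1' : 0 < 1 - t by rewrite subr_gt0.
have zero (h : I -> R) : (forall i, 0 <= h i) -> \sum_(i <- r) h i = 0 ->
    forall i, i \in r -> h i = 0.
  move=> h0 /eqP; rewrite psumr_eq0 // => /allP hr i ir; exact/eqP/(hr i ir).
move: F0; rewrite le_eqVlt => /predU1P[/esym FE|F0].
  rewrite FE powR0 ?gt_eqF // mul0r big_seq big1 // => i ir.
  by rewrite (zero f) // powR0 ?gt_eqF // mul0r.
move: G0; rewrite le_eqVlt => /predU1P[/esym GE|G0].
  rewrite GE [X in _ * X]powR0 ?gt_eqF // mulr0 big_seq big1 // => i ir.
  by rewrite (zero g) // [X in _ * X]powR0 ?gt_eqF // mulr0.
set F := \sum_(i <- r) f i in F0 *; set G := \sum_(i <- r) g i in G0 *.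
have nF : 0 < F `^ t * G `^ (1 - t) by rewrite mulr_gt0 ?powR_gt0.
rewrite -[leRHS]mulr1 -ler_pdivrMl // mulr_sumr.
have one : t * (\sum_(i <- r) f i / F) + (1 - t) * (\sum_(i <- r) g i / G) = 1.
  by rewrite -!mulr_suml !mulfV ?gt_eqF //; lra.
rewrite -[leRHS]one !mulr_sumr -big_split /=; apply: ler_sum => i _.
apply: le_trans (@young_powR t (f i / F) (g i / G) t01 _ _);
  rewrite ?divr_ge0 ?f0 ?g0 ?(ltW F0) ?(ltW G0) //.
have powRV x u : 0 <= x -> x^-1 `^ u = (x `^ u)^-1.
  by move=> x0; rewrite -powR_inv1 // powRAC powR_inv1 ?powR_ge0.
rewrite !powRM ?invr_ge0 ?(ltW F0) ?(ltW G0) // !powRV ?(ltW F0) ?(ltW G0) //.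
rewrite invfM; set a := _^-1; set b := _^-1; set c := _ `^ _; set d := g i `^ _.
by have -> : a * b * (c * d) = c * a * (d * b) by ring.
Qed.

End PowerInequalities.

(** * Khinchine's inequality with exponents between 1 and 2 *)

Section KhinchineLq.
Variable R : realType.
Implicit Types (l : seq R) (q x : R).

Lemma powR_sqr_half x q : (x ^+ 2) `^ (q / 2) = `|x| `^ q.
Proof.
rewrite -real_normK ?num_real // -powR_mulrn // -powRrM; by congr (_ `^ _); field.
Qed.

(** Homogeneity: it suffices to treat the square sum 1/2. *)
Lemma khinchine_scale q (K : R) l : 0 < q -> 0 <= K ->
  (forall l', sumpow 2 l' = 1 / 2 -> K <= rad l' (fun x => `|x| `^ q)) ->
  K * (2 * sumpow 2 l) `^ (q / 2) <= rad l (fun x => `|x| `^ q).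
Proof.
move=> q0 K0 H.
have S0 : 0 <= sumpow 2 l by apply: sumpow_ge0.
move: S0; rewrite le_eqVlt => /predU1P[<-|S0].
  rewrite mulr0 powR0 ?mulr0 ?gt_eqF ?divr_gt0 //.
  by rewrite -(rad_cst l 0); apply: ler_rad => x; exact: powR_ge0.
set S := sumpow 2 l in S0 *.
pose c := Num.sqrt (2 * S).
have c0 : 0 < c by rewrite sqrtr_gt0 mulr_gt0.
have c2 : c ^+ 2 = 2 * S by rewrite sqr_sqrtr // mulr_ge0 // ltW.
have lE : l = [seq c * a | a <- [seq a / c | a <- l]].
  rewrite -map_comp -[LHS]map_id; apply: eq_map => a /=.
  by rewrite mulrC divfK // gt_eqF.
rewrite [in leRHS]lE rad_map; [|exact: mulrDr|exact: mulrN].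
have -> : (2 * S) `^ (q / 2) = c `^ q by rewrite -c2 powR_sqr_half gtr0_norm.
have -> : rad [seq a / c | a <- l] (fun x => `|c * x| `^ q) =
    c `^ q * rad [seq a / c | a <- l] (fun x => `|x| `^ q).
  by rewrite -radZ; apply: eq_rad => x; rewrite normrM powRM // gtr0_norm.
rewrite mulrC ler_wpM2l ?powR_ge0 //; apply: H.
rewrite /sumpow big_map; under eq_bigr do rewrite exprMn.
rewrite -mulr_suml -/(sumpow 2 l) -/S exprVn c2 invfM; field.
by rewrite gt_eqF.
Qed.

(** Below 4/3: [|x| ^ (4/3)] is a geometric mean of [|x| ^ q] and [x ^ 2], so by
    Young's inequality [|x| ^ q] is at least a combination
    [A |x| ^ (4/3) - B x ^ 2], with equality at [|x| = 1] and at 0. *)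
Lemma khinchine_low q l : 1 <= q <= 4 / 3 ->
  (sumpow 2 l) `^ (q / 2) <= 2 `^ (1 - q / 2) * rad l (fun x => `|x| `^ q).
Proof.
move=> /andP[q1 q43].
have : 1 / 2 * (2 * sumpow 2 l) `^ (q / 2) <= rad l (fun x => `|x| `^ q).
  apply: khinchine_scale => [||l' l2]; [lra|lra|].
  pose A : R := (2 - q) * 3 / 2; pose B : R := (4 - 3 * q) / 2.
  have A0 : 0 < A by rewrite /A; lra.
  have iA : 0 <= A^-1 <= 1.
    by rewrite invr_ge0 ltW //= invf_le1 // /A; lra.
  have pt x : A * pow43 x + - B * (0 + x) ^+ 2 <= `|x| `^ q.
    have := @young_powR R A^-1 (`|x| `^ q) (x ^+ 2) iA (powR_ge0 _ _) (sqr_ge0 _).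
    have -> : (`|x| `^ q) `^ A^-1 * (x ^+ 2) `^ (1 - A^-1) = pow43 x.
      have [->|x0] := eqVneq x 0.
        rewrite /pow43 normr0 [in RHS]powR0; last by rewrite gt_eqF //; lra.
        by rewrite powR0 ?powR0 ?mul0r // ?invr_eq0 gt_eqF //; lra.
      have -> : 1 - A^-1 = (2 * (1 - A^-1)) / 2 by field; rewrite gt_eqF.
      rewrite powR_sqr_half -powRrM -powRD ?normr_eq0 ?x0 ?implybT //.
      rewrite /pow43; congr (_ `^ _); rewrite /A; field.
      by apply/eqP; lra.
    move=> h; have := ler_wpM2l (ltW A0) h.
    rewrite mulrDr !mulrA mulfV ?gt_eqF // mul1r mulrBr mulr1 mulfV ?gt_eqF // add0r.
    rewrite /A /B; move: (pow43 x) (_ `^ _) (x ^+ 2) => a b c; lra.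
  have := ler_rad l' pt; rewrite radD !radZ rad_sqr l2 expr0n /= add0r.
  have := khinchine43 l2; move=> k1; have := ler_wpM2l (ltW A0) k1.
  rewrite /A /B; lra.
have S0 : 0 <= sumpow 2 l by apply: sumpow_ge0.
rewrite powRM // => h; have := ler_wpM2l (powR_ge0 2 (1 - q / 2)) h.
apply: le_trans; rewrite le_eqVlt; apply/orP; left; apply/eqP.
rewrite mulrA [_ * (1 / 2)]mulrC -!mulrA [2 `^ _ * (_ * _)]mulrA -powRD ?pnatr_eq0 ?implybT //.
by rewrite subrK powRr1 //; field.
Qed.

(** Above 4/3: Jensen's inequality for a power of [|x| ^ (4/3)], through the
    tangent of that power at 1/2 given by [bernoulli_powR]. *)
Lemma khinchine_high q l : 4 / 3 <= q ->
  (sumpow 2 l) `^ (q / 2) <= 2 `^ (q / 4) * rad l (fun x => `|x| `^ q).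
Proof.
move=> q43; pose th : R := 3 * q / 4.
have th1 : 1 <= th by rewrite /th; lra.
have : 2 `^ (- th) * (2 * sumpow 2 l) `^ (q / 2) <= rad l (fun x => `|x| `^ q).
  apply: khinchine_scale => [||l' l2]; [lra|exact: powR_ge0|].
  have pt x : 2 `^ (- th) * (1 - th + 2 * th * pow43 x) <= `|x| `^ q.
    have px : 0 <= 2 * pow43 x by have := pow43_ge0 x; lra.
    have := bernoulli_powR th1 px.
    rewrite powRM ?pow43_ge0 // {2}/pow43 -powRrM.
    have -> : 4 / 3 * th = q by rewrite /th; field.
    move=> h; have := ler_wpM2l (powR_ge0 2 (- th)) h.
    rewrite mulrA -powRD ?pnatr_eq0 ?implybT // addNr powRr0 mul1r.
    apply: le_trans; rewrite ler_wpM2l ?powR_ge0 //; lra.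
  have := ler_rad l' pt; rewrite radZ radD rad_cst radZ; apply: le_trans.
  rewrite -[leLHS]mulr1 ler_wpM2l ?powR_ge0 //.
  have th0 : 0 <= 2 * th by lra.
  have := ler_wpM2l th0 (khinchine43 l2); lra.
have S0 : 0 <= sumpow 2 l by apply: sumpow_ge0.
rewrite powRM // => h; have := ler_wpM2l (powR_ge0 2 (q / 4)) h.
apply: le_trans; rewrite !mulrA -!powRD ?pnatr_eq0 ?implybT //.
have -> : q / 4 - th + q / 2 = 0 by rewrite /th; field.
by rewrite powRr0 mul1r.
Qed.

End KhinchineLq.

(** * Mixed norms of the matrix of a bilinear form *)

Section FiniteHardyLittlewood.
Variable R : realType.

(** Cancels the power of the left-hand side that Hoelder's inequality leaves on
    the right, also when that side is 0. *)
Lemma powR_absorb (q Z D : R) : 1 <= q -> 0 <= Z -> 0 <= D ->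
  Z <= D * Z `^ (1 - q^-1) -> Z `^ q^-1 <= D.
Proof.
move=> q1 Z0 D0 h.
have q0 : 0 < q by lra.
move: Z0; rewrite le_eqVlt => /predU1P[<-|Z0]; first by rewrite powR0 // gt_eqF // invr_gt0.
have p0 : 0 < Z `^ (1 - q^-1) by rewrite powR_gt0.
rewrite -(ler_pM2r p0) -powRD ?(gt_eqF Z0) ?implybT //.
have -> : q^-1 + (1 - q^-1) = 1 by ring.
by rewrite powRr1 // ltW.
Qed.

(** Minkowski's inequality for the mixed norms [l_r (l_1)] and [l_1 (l_r)]. *)
Lemma minkowski_mixed (I J : finType) (b : I -> J -> R) r : 1 <= r ->
  (forall i j, 0 <= b i j) ->
  (\sum_i (\sum_j b i j) `^ r) `^ r^-1 <= \sum_j (\sum_i b i j `^ r) `^ r^-1.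
Proof.
move=> r1 b0; have r0 : 0 < r by lra.
have B0 i : 0 <= \sum_j b i j by apply: sumr_ge0.
apply: powR_absorb => //.
- by apply: sumr_ge0 => i _; exact: powR_ge0.
- by apply: sumr_ge0 => j _; exact: powR_ge0.
rewrite [leLHS](_ : _ = \sum_j \sum_i b i j * (\sum_j b i j) `^ (r - 1)); last first.
  rewrite exchange_big; apply: eq_bigr => i _.
  by rewrite -mulr_suml mulr_powRB1.
rewrite mulr_suml; apply: ler_sum => j _.
have rr : 0 <= r^-1 <= 1 by rewrite invr_ge0 ltW //= invf_le1.
have := @hoelder_sum R I (index_enum I) (fun i => b i j `^ r) (fun i => (\sum_j b i j) `^ r)
  r^-1 rr (fun i => powR_ge0 _ _) (fun i => powR_ge0 _ _).
apply: le_trans; apply: ler_sum => i _.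
rewrite -!powRrM mulfV ?gt_eqF // powRr1 // mulrBr mulr1 mulfV ?gt_eqF //.
Qed.

Variables (I J : finType) (a : I -> J -> R) (q N : R).
Hypothesis q12 : 1 <= q <= 2.
Hypothesis N0 : 0 <= N.
Hypothesis form_bound : forall y : J -> R, (forall k, `|y k| <= 1) ->
  \sum_j `|\sum_k y k * a j k| `^ q <= N `^ q.

Let q1 : 1 <= q. Proof. by have /andP[] := q12. Qed.
Let q2 : q <= 2. Proof. by have /andP[] := q12. Qed.
Let q0 : 0 < q. Proof. by have := q1; lra. Qed.

(** The squares of the Euclidean norms of the rows and of the columns. *)
Let row2 j := \sum_k a j k ^+ 2.
Let col2 k := \sum_j a j k ^+ 2.

Let col2_ge0 k : 0 <= col2 k. Proof. by apply: sumr_ge0 => j _; exact: sqr_ge0. Qed.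

(** Khinchine's inequality in each row, with the same signs for all rows; the
    mean over these signs is at most the value at some choice of them. *)
Lemma row_bound (K : R) : 0 <= K ->
  (forall l, (sumpow 2 l) `^ (q / 2) <= K * rad l (fun x => `|x| `^ q)) ->
  \sum_j row2 j `^ (q / 2) <= K * N `^ q.
Proof.
move=> K0 khin.
pose v k : {ffun I -> R} := [ffun j => a j k].
pose s := index_enum J.
have rowE j : row2 j = sumpow 2 [seq a j k | k <- s] by rewrite /sumpow big_map.
have step : \sum_j row2 j `^ (q / 2) <=
    K * rad [seq v k | k <- s] (fun x => \sum_j `|x j| `^ q).
  rewrite rad_sum mulr_sumr; apply: ler_sum => j _; rewrite rowE.
  apply: le_trans (khin _) _; rewrite le_eqVlt; apply/orP; left; apply/eqP.
  congr (_ * _).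
  have -> : [seq a j k | k <- s] = [seq x j | x : {ffun I -> R} <- [seq v k | k <- s]].
    by rewrite -map_comp; apply: eq_map => k /=; rewrite ffunE.
  by rewrite rad_map // => x *; rewrite ffunE.
apply: le_trans step _; rewrite ler_wpM2l //.
have [y y1 hy] := rad_le_exists v (fun x : {ffun I -> R} => \sum_j `|x j| `^ q) (index_enum_uniq J).
apply: le_trans hy _; apply: le_trans (form_bound y1).
rewrite le_eqVlt; apply/orP; left; apply/eqP; apply: eq_bigr => j _.
congr (`|_| `^ _); rewrite sum_ffunE; apply: eq_bigr => k _.
by rewrite !ffunE.
Qed.

(** Khinchine's inequality in [L^1] for the columns of the matrix with rows
    multiplied by [c j ^ (q - 1)]: up to normalization these weights form a
    vector of the unit ball of the dual space, and Hoelder's inequality over [j]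
    gives back the norm of the form. *)
Lemma weight_bound (c : I -> R) : (forall j, 0 <= c j) ->
  \sum_k (\sum_j (c j `^ (q - 1) * a j k) ^+ 2) `^ (1 / 2) <=
  2 `^ (1 / 2) * N * (\sum_j c j `^ q) `^ (1 - q^-1).
Proof.
move=> c0; pose x j := c j `^ (q - 1).
have x0 j : 0 <= x j by exact: powR_ge0.
pose v j : {ffun J -> R} := [ffun k => x j * a j k].
pose s := index_enum I.
have step : \sum_k (\sum_j (x j * a j k) ^+ 2) `^ (1 / 2) <=
    2 `^ (1 / 2) * rad [seq v j | j <- s] (fun z => \sum_k `|z k|).
  rewrite rad_sum mulr_sumr; apply: ler_sum => k _.
  have one : 1 <= (1 : R) <= 4 / 3 by lra.
  have := @khinchine_low R 1 [seq x j * a j k | j <- s] one.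
  rewrite /sumpow big_map => /le_trans; apply.
  have -> : 1 - 1 / 2 = 1 / 2 :> R by field.
  rewrite le_eqVlt; apply/orP; left; apply/eqP; congr (_ * _).
  have -> : [seq x j * a j k | j <- s] = [seq z k | z : {ffun J -> R} <- [seq v j | j <- s]].
    by rewrite -map_comp; apply: eq_map => j /=; rewrite ffunE.
  rewrite rad_map; [|by move=> *; rewrite ffunE|by move=> *; rewrite ffunE].
  by apply: eq_rad => z; rewrite powRr1.
apply: le_trans step _; rewrite -mulrA ler_wpM2l ?powR_ge0 //.
have [e e1 he] := rad_le_exists v (fun z : {ffun J -> R} => \sum_k `|z k|) (index_enum_uniq I).
pose z := \sum_(j <- index_enum I) e j *: v j.
apply: le_trans (he : _ <= \sum_k `|z k|) _.
pose y k := Num.sg (z k).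
have y1 k : `|y k| <= 1 by rewrite normr_sg lern1 leq_b1.
have zE k : z k = \sum_j e j * (x j * a j k).
  by rewrite sum_ffunE; apply: eq_bigr => j _; rewrite !ffunE.
pose b j := \sum_k y k * a j k.
have -> : \sum_k `|z k| = \sum_j e j * (x j * b j).
  under eq_bigr => k _ do rewrite normrEsg -/(y k) zE mulr_sumr.
  rewrite exchange_big; apply: eq_bigr => j _ /=.
  rewrite /b !mulr_sumr; apply: eq_bigr => k _; ring.
have : \sum_j e j * (x j * b j) <= \sum_j x j * `|b j|.
  apply: ler_sum => j _; apply: le_trans (ler_norm _) _.
  rewrite !normrM (ger0_norm (x0 j)) -[leRHS]mul1r ler_wpM2r ?mulr_ge0 //.
move=> /le_trans; apply.
have qi : 0 <= 1 - q^-1 <= 1.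
  by rewrite subr_ge0 invf_le1 // q1 gerBl invr_ge0 ltW.
have := @hoelder_sum R I (index_enum I) (fun j => c j `^ q) (fun j => `|b j| `^ q)
  (1 - q^-1) qi (fun j => powR_ge0 _ _) (fun j => powR_ge0 _ _).
have -> : \sum_(i <- index_enum I) (c i `^ q) `^ (1 - q^-1) * (`|b i| `^ q) `^ (1 - (1 - q^-1)) =
    \sum_j x j * `|b j|.
  apply: eq_bigr => j _; rewrite -!powRrM mulrBr mulr1 mulfV ?gt_eqF // subKr mulfV ?gt_eqF //.
  by rewrite powRr1.
move=> /le_trans; apply; rewrite mulrC ler_wpM2r ?powR_ge0 // subKr.
have iq0 : 0 <= q^-1 by rewrite invr_ge0 ltW.
apply: le_trans (ge0_ler_powR iq0 _ _ (form_bound y1)) _; rewrite ?nnegrE ?powR_ge0 //.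
  by apply: sumr_ge0 => j _; exact: powR_ge0.
by rewrite -powRrM mulfV ?gt_eqF // powRr1.
Qed.

(* The weight that is split off by Hoelder's inequality in [column_bound]. *)
Let c j := \sum_k a j k ^+ 2 / (col2 k) `^ (1 / 2).

Let c_ge0 j : 0 <= c j.
Proof. by apply: sumr_ge0 => k _; rewrite divr_ge0 ?sqr_ge0 ?powR_ge0. Qed.

(** [weight_bound] for these weights, after the Cauchy-Schwarz inequality in each
    column; the sum of the [c j ^ q] occurs on both sides. *)
Lemma column_weight : \sum_j c j `^ q <= (2 `^ (1 / 2) * N) `^ q.
Proof.
have D0 : 0 <= 2 `^ (1 / 2) * N :> R by rewrite mulr_ge0 ?powR_ge0.
have Z0 : 0 <= \sum_j c j `^ q by apply: sumr_ge0 => j _; exact: powR_ge0.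
suff : (\sum_j c j `^ q) `^ q^-1 <= 2 `^ (1 / 2) * N.
  move=> h; have := ge0_ler_powR (ltW q0) _ _ h; rewrite !nnegrE powR_ge0 => /(_ isT D0).
  by rewrite -powRrM mulVf ?gt_eqF // powRr1.
apply: powR_absorb => //; apply: le_trans (weight_bound c_ge0).
rewrite [leLHS](_ : _ = \sum_k (\sum_j c j `^ (q - 1) * a j k ^+ 2) / col2 k `^ (1 / 2)); last first.
  under eq_bigr => j _ do rewrite -mulr_powRB1 // /c mulr_suml.
  rewrite exchange_big; apply: eq_bigr => k _ /=.
  rewrite mulr_suml; apply: eq_bigr => j _; rewrite -/(c j); ring.
apply: ler_sum => k _.
have half : 0 <= (1 / 2 : R) <= 1 by lra.
have := @hoelder_sum R I (index_enum I) (fun j => (c j `^ (q - 1) * a j k) ^+ 2)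
  (fun j => a j k ^+ 2) (1 / 2) half (fun j => sqr_ge0 _) (fun j => sqr_ge0 _).
have -> : 1 - 1 / 2 = 1 / 2 :> R by field.
have -> : \sum_(i <- index_enum I) ((c i `^ (q - 1) * a i k) ^+ 2) `^ (1 / 2) * (a i k ^+ 2) `^ (1 / 2)
   = \sum_j c j `^ (q - 1) * a j k ^+ 2.
  apply: eq_bigr => j _; rewrite !powR_sqr_half !powRr1 // normrM (ger0_norm (powR_ge0 _ _)).
  by rewrite -mulrA -expr2 real_normK ?num_real.
rewrite -/(col2 k).
have := col2_ge0 k; rewrite le_eqVlt => /predU1P[<-|s0].
  by rewrite powR0 ?gt_eqF // invr0 !mulr0 => _; exact: powR_ge0.
by rewrite ler_pdivrMr ?powR_gt0.
Qed.

(** The sum of the [col2 k ^ (q / 2)] splits into the terms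
    [(a j k ^+ 2 / col2 k ^ (1 / 2)) ^ (2 - q) * (a j k ^+ 2) ^ (q - 1)].  Hoelder's
    inequality over [k], then over [j], separates the weights [c j] from the rows. *)
Lemma column_bound (K : R) : 0 <= K ->
  \sum_j row2 j `^ (q / 2) <= K * N `^ q ->
  \sum_k col2 k `^ (q / 2) <= 2 `^ (1 - q / 2) * K `^ (2 - 2 / q) * N `^ q.
Proof.
move=> K0 rowb.
have t01 : 0 <= 2 - q <= 1 by have := q1; have := q2; lra.
have iq : q^-1 * q = 1 by rewrite mulVf ?gt_eqF.
have iq1 : q^-1 <= 1 by rewrite invf_le1.
have iq2 : 1 / 2 <= q^-1 by rewrite -[X in X <= _]invrK lef_pV2 ?posrE //; have := q2; lra.
have s01 : 0 <= 2 / q - 1 <= 1 by lra.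
have -> : \sum_k col2 k `^ (q / 2) =
    \sum_j \sum_k (a j k ^+ 2 / col2 k `^ (1 / 2)) `^ (2 - q) * (a j k ^+ 2) `^ (1 - (2 - q)).
  rewrite exchange_big; apply: eq_bigr => k _ /=.
  have := col2_ge0 k; rewrite le_eqVlt => /predU1P[E|s0].
    rewrite -E powR0 ?gt_eqF ?divr_gt0 // big1 // => j _.
    have := E => /esym/eqP; rewrite psumr_eq0; last by move=> i _; exact: sqr_ge0.
    move=> /allP/(_ j (mem_index_enum _)) /= /eqP ->.
    have [e|ne] := eqVneq (2 - q) 0; first by rewrite e subr0 powRr1 ?mulr0.
    by rewrite mul0r powR0 ?mul0r.
  have -> : col2 k `^ (q / 2) = \sum_j a j k ^+ 2 * col2 k `^ (q / 2 - 1).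
    by rewrite -mulr_suml mulr_powRB1 // ?ltW // divr_gt0.
  apply: eq_bigr => j _.
  have [->|ne] := eqVneq (a j k) 0.
    rewrite expr0n /= !mul0r.
    have [e|ne] := eqVneq (2 - q) 0; first by rewrite e subr0 powRr1 ?mulr0.
    by rewrite powR0 ?mul0r.
  have a2 : a j k ^+ 2 != 0 by rewrite expf_neq0.
  rewrite powRM ?sqr_ge0 ?invr_ge0 ?powR_ge0 // [RHS]mulrAC.
  rewrite -powRD ?a2 ?implybT //.
  rewrite subrKC powRr1 ?sqr_ge0 //; congr (_ * _).
  by rewrite -powRN -powRrM; congr (_ `^ _); field.
apply: (@le_trans _ _ (\sum_j (c j `^ q) `^ (2 / q - 1) * (row2 j `^ (q / 2)) `^ (1 - (2 / q - 1)))).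
  apply: ler_sum => j _.
  have := @hoelder_sum R J (index_enum J) (fun k => a j k ^+ 2 / col2 k `^ (1 / 2))
    (fun k => a j k ^+ 2) (2 - q) t01 (fun k => divr_ge0 (sqr_ge0 _) (powR_ge0 _ _)) (fun k => sqr_ge0 _).
  move=> /le_trans; apply; rewrite -/(c j) -/(row2 j) -!powRrM.
  rewrite le_eqVlt; apply/orP; left; apply/eqP.
  by congr (_ `^ _ * _ `^ _); field; rewrite gt_eqF.
have := @hoelder_sum R I (index_enum I) (fun j => c j `^ q) (fun j => row2 j `^ (q / 2))
  (2 / q - 1) s01 (fun j => powR_ge0 _ _) (fun j => powR_ge0 _ _).
move=> /le_trans; apply.
have /andP[s0 s1] := s01; have s1' : 0 <= 1 - (2 / q - 1) by lra.
have cs : 0 <= \sum_j c j `^ q by apply: sumr_ge0 => j _; exact: powR_ge0.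
have rs : 0 <= \sum_j row2 j `^ (q / 2) by apply: sumr_ge0 => j _; exact: powR_ge0.
have D0 : 0 <= 2 `^ (1 / 2) * N :> R by rewrite mulr_ge0 ?powR_ge0.
have h1 := ge0_ler_powR s0 _ _ column_weight; rewrite !nnegrE cs powR_ge0 in h1.
have h2 := ge0_ler_powR s1' _ _ rowb; rewrite !nnegrE rs mulr_ge0 ?powR_ge0 // in h2.
apply: le_trans (ler_pM (powR_ge0 _ _) (powR_ge0 _ _) (h1 isT isT) (h2 isT isT)) _.
rewrite -powRrM !powRM ?powR_ge0 // -!powRrM.
have -> : q * (2 / q - 1) = 2 - q by field; rewrite gt_eqF.
have -> : q * (1 - (2 / q - 1)) = 2 * q - 2 by field; rewrite gt_eqF.
have -> : 1 / 2 * (2 - q) = 1 - q / 2 by field.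
have -> : 1 - (2 / q - 1) = 2 - 2 / q by field; rewrite gt_eqF.
have -> : 2 `^ (1 - q / 2) * N `^ (2 - q) * (K `^ (2 - 2 / q) * N `^ (2 * q - 2)) =
   2 `^ (1 - q / 2) * K `^ (2 - 2 / q) * (N `^ (2 - q) * N `^ (2 * q - 2)) by ring.
rewrite ler_wpM2l ?mulr_ge0 ?powR_ge0 //.
have [->|N1] := eqVneq N 0.
  have [e|ne] := eqVneq (2 - q) 0.
    have -> : 2 * q - 2 = q by move/eqP: e; rewrite subr_eq0 => /eqP <-; ring.
    by rewrite e powRr0 mul1r.
  by rewrite powR0 // mul0r powR_ge0.
by rewrite -powRD ?N1 ?implybT // (_ : 2 - q + (2 * q - 2) = q) //; ring.
Qed.

End FiniteHardyLittlewood.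

(** * Interpolation and the finite inequality *)

Section Interpolation.
Variable R : realType.

(** Hoelder's inequality between the mixed norms [l_q (l_2)] (by rows) and
    [l_2 (l_q)], the latter being dominated by [l_q (l_2)] by columns. *)
Lemma mixed_interpolation (I J : finType) (a : I -> J -> R) (q : R) :
  1 <= q <= 2 ->
  \sum_j \sum_k `|a j k| `^ (4 * q / (q + 2)) <=
  (\sum_j (\sum_k a j k ^+ 2) `^ (q / 2)) `^ (2 / (q + 2)) *
  (\sum_k (\sum_j a j k ^+ 2) `^ (q / 2)) `^ (2 / (q + 2)).
Proof.
move=> /andP[q1 q2]; have q0 : 0 < q by lra.
have p0 : 0 < q + 2 by lra.
pose row2 j := \sum_k a j k ^+ 2; pose w j := \sum_k `|a j k| `^ q.
have w0 j : 0 <= w j by apply: sumr_ge0 => k _; exact: powR_ge0.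
have t01 : 0 <= q / (q + 2) <= 1.
  by rewrite divr_ge0 ?(ltW q0) ?(ltW p0) //= ler_pdivrMr // mul1r; lra.
have s01 : 0 <= 2 / (q + 2) <= 1.
  by rewrite divr_ge0 ?(ltW p0) //= ler_pdivrMr // mul1r; lra.
have ts : 1 - q / (q + 2) = 2 / (q + 2) by field; rewrite gt_eqF.
have st : 1 - 2 / (q + 2) = q / (q + 2) by field; rewrite gt_eqF.
have rows : \sum_j \sum_k `|a j k| `^ (4 * q / (q + 2)) <=
    \sum_j (row2 j `^ (q / 2)) `^ (2 / (q + 2)) * (w j `^ (2 / q)) `^ (1 - 2 / (q + 2)).
  apply: ler_sum => j _.
  have := @hoelder_sum R J (index_enum J) (fun k => a j k ^+ 2) (fun k => `|a j k| `^ q)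
    (q / (q + 2)) t01 (fun k => sqr_ge0 _) (fun k => powR_ge0 _ _).
  rewrite -/(w j) -/(row2 j) ts st -!powRrM.
  have -> : q / 2 * (2 / (q + 2)) = q / (q + 2) by field; rewrite gt_eqF.
  have -> : 2 / q * (q / (q + 2)) = 2 / (q + 2) by field; rewrite !gt_eqF.
  apply: le_trans; apply: ler_sum => k _.
  have -> : q / (q + 2) = 2 * q / (q + 2) / 2 by field; rewrite gt_eqF.
  rewrite powR_sqr_half -powRrM.
  have [e|ne] := eqVneq (`|a j k|) 0.
    have ne : 4 * q / (q + 2) != 0 by rewrite gt_eqF // divr_gt0 // mulr_gt0.
    by rewrite e powR0 // mulr_ge0 ?powR_ge0.
  rewrite -powRD ?ne ?implybT // le_eqVlt; apply/orP; left; apply/eqP.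
  by congr (_ `^ _); field; rewrite gt_eqF.
apply: le_trans rows _.
have := @hoelder_sum R I (index_enum I) (fun j => row2 j `^ (q / 2)) (fun j => w j `^ (2 / q))
  (2 / (q + 2)) s01 (fun j => powR_ge0 _ _) (fun j => powR_ge0 _ _).
move=> /le_trans; apply; apply: ler_wpM2l; first exact: powR_ge0.
have r1 : 1 <= 2 / q by rewrite ler_pdivlMr // mul1r.
have := @minkowski_mixed R I J (fun j k => `|a j k| `^ q) (2 / q) r1 (fun j k => powR_ge0 _ _).
rewrite invf_div -/w.
have -> : \sum_j (\sum_i (`|a i j| `^ q) `^ (2 / q)) `^ (q / 2) =
    \sum_k (\sum_j a j k ^+ 2) `^ (q / 2).
  apply: eq_bigr => k _; congr (_ `^ _); apply: eq_bigr => j _.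
  rewrite -powRrM mulrC divfK ?gt_eqF // powR_mulrn //.
  by rewrite real_normK ?num_real.
have W0 : 0 <= \sum_i w i `^ (2 / q) by apply: sumr_ge0 => i _; exact: powR_ge0.
have s0 : 0 <= 2 / (q + 2) by have /andP[] := s01.
have C0 : 0 <= \sum_k (\sum_j a j k ^+ 2) `^ (q / 2) by apply: sumr_ge0 => i _; exact: powR_ge0.
move=> /(ge0_ler_powR s0); rewrite !nnegrE powR_ge0 C0 => /(_ isT isT).
apply: le_trans; rewrite -powRrM st le_eqVlt; apply/orP; left; apply/eqP.
by congr (_ `^ _); field; rewrite gt_eqF.
Qed.

(** The finite form of the inequality. The Khinchine constant in the exponent
    [q] enters with the total exponent [3 - 2 / q], from the rows and from the
    columns, and [K ^ (3 - 2 / q) <= 2 ^ (q / 2)] holds both for [khinchine_low]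
    and for [khinchine_high]. *)
Theorem finite_hardy_littlewood (I J : finType) (a : I -> J -> R) (q N : R) :
  1 <= q <= 2 -> 0 <= N ->
  (forall y : J -> R, (forall k, `|y k| <= 1) ->
    \sum_j `|\sum_k y k * a j k| `^ q <= N `^ q) ->
  (\sum_j \sum_k `|a j k| `^ (4 * q / (q + 2))) `^ (4 * q / (q + 2))^-1 <=
  2 `^ (1 / (2 * q)) * N.
Proof.
move=> q12 N0 form; have /andP[q1 q2] := q12; have q0 : 0 < q by lra.
have p0 : 0 < q + 2 by lra.
have [K [K0 khin Kq]] : exists K : R, [/\ 0 <= K,
    forall l, (sumpow 2 l) `^ (q / 2) <= K * rad l (fun x => `|x| `^ q) &
    K `^ (3 - 2 / q) <= 2 `^ (q / 2)].
  have e0 : 0 <= 3 - 2 / q.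
    by rewrite subr_ge0 ler_pdivrMr //; lra.
  have [q43|q43] := leP q (4 / 3).
    exists (2 `^ (1 - q / 2)); split; first exact: powR_ge0.
      by move=> l; apply: khinchine_low; rewrite q1.
    rewrite -powRrM ler_powR ?ler1n //.
    rewrite -subr_ge0.
    have -> : q / 2 - (1 - q / 2) * (3 - 2 / q) = 2 * (q - 1) ^+ 2 / q.
      by field; rewrite gt_eqF.
    by rewrite divr_ge0 ?(ltW q0) // mulr_ge0 ?sqr_ge0.
  exists (2 `^ (q / 4)); split; first exact: powR_ge0.
    by move=> l; apply: khinchine_high; exact: ltW.
  rewrite -powRrM ler_powR ?ler1n //.
  have -> : q / 4 * (3 - 2 / q) = (3 * q - 2) / 4 by field; rewrite gt_eqF.
  lra.
have rowb := row_bound form K0 khin.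
have colb := column_bound q12 N0 form K0 rowb.
have mix := mixed_interpolation a q12.
set A := \sum_j (\sum_k a j k ^+ 2) `^ (q / 2) in rowb colb mix.
set B := \sum_k (\sum_j a j k ^+ 2) `^ (q / 2) in colb mix.
set X := \sum_j \sum_k _ in mix *.
have A0 : 0 <= A by apply: sumr_ge0 => j _; exact: powR_ge0.
have B0 : 0 <= B by apply: sumr_ge0 => j _; exact: powR_ge0.
have X0 : 0 <= X by apply: sumr_ge0 => j _; apply: sumr_ge0 => k _; exact: powR_ge0.
have Nq0 : 0 <= N `^ q by exact: powR_ge0.
have AB : A * B <= 2 * N `^ (2 * q).
  apply: le_trans (ler_pM A0 B0 rowb colb) _.
  have -> : N `^ (2 * q) = N `^ q * N `^ q.
    by rewrite mulrC powRrM powR_mulrn // expr2.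
  have -> : K * N `^ q * (2 `^ (1 - q / 2) * K `^ (2 - 2 / q) * N `^ q) =
    2 `^ (1 - q / 2) * (K * K `^ (2 - 2 / q)) * (N `^ q * N `^ q) by ring.
  rewrite ler_wpM2r ?mulr_ge0 //.
  have -> : K * K `^ (2 - 2 / q) = K `^ (3 - 2 / q).
    have -> : 2 - 2 / q = (3 - 2 / q) - 1 by ring.
    rewrite mulr_powRB1 // subr_gt0 ltr_pdivrMr //; lra.
  apply: le_trans (ler_wpM2l (powR_ge0 _ _) Kq) _.
  by rewrite -powRD ?pnatr_eq0 ?implybT // subrK powRr1.
have s0 : 0 <= 2 / (q + 2) by rewrite divr_ge0 ?(ltW p0).
have i0 : 0 <= (4 * q / (q + 2))^-1.
  by rewrite invr_ge0 divr_ge0 ?(ltW p0) // mulr_ge0 // ltW.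
have AB0 : 0 <= A * B by rewrite mulr_ge0.
have N20 : 0 <= 2 * N `^ (2 * q) by rewrite mulr_ge0 // powR_ge0.
have XAB : X <= (2 * N `^ (2 * q)) `^ (2 / (q + 2)).
  apply: le_trans mix _; rewrite -powRM //.
  by apply: ge0_ler_powR; rewrite ?nnegrE.
apply: le_trans (ge0_ler_powR i0 _ _ XAB) _; rewrite ?nnegrE ?powR_ge0 //.
rewrite -powRrM.
have -> : 2 / (q + 2) * (4 * q / (q + 2))^-1 = 1 / (2 * q).
  by field; rewrite !gt_eqF.
rewrite powRM ?powR_ge0 // -powRrM.
have -> : 2 * q * (1 / (2 * q)) = 1 by field; rewrite gt_eqF.
by rewrite powRr1.
Qed.

End Interpolation.

(** * The sequence spaces *)

Lemma nonexpansive_continuous (R : realType) (V : normedModType R) (f : V -> R) :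
  (forall x y, f (x - y) = f x - f y) -> (forall x, `|f x| <= `|x|) ->
  continuous f.
Proof.
move=> fB fle x; apply/cvgrPdist_lt => e e0.
apply: filterS (@nbhsx_ballx R V x e e0) => y.
rewrite -ball_normE /= -fB => xy.
by rewrite (le_lt_trans (fle _) xy).
Qed.

Section SequenceSpaces.
Variables (R : realType) (p : \bar R) (p1 : (1 <= p)%E).

Lemma ell_valD (x y : ell p1) k : (x + y) k = x k + y k.
Proof. by have /(congr1 (fun f => f k)) := GRing.valD x y. Qed.

Lemma ell_valZ c (x : ell p1) k : (c *: x) k = c * x k.
Proof. by have /(congr1 (fun f => f k)) := GRing.valZ c x. Qed.

Lemma ell_val0 k : (0 : ell p1) k = 0.
Proof. by have := ell_valZ 0 0 k; rewrite scale0r mul0r. Qed.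

Lemma ell_val_sum (n : nat) (x : 'I_n -> R) (k : nat) :
  (\sum_(j < n) x j *: unit_seq j : ell p1) k = \sum_(j < n | k == j) x j.
Proof.
rewrite (big_morph (fun z : ell p1 => z k) (fun a b => ell_valD a b k) (ell_val0 k)).
rewrite [RHS]big_mkcond /=; apply: eq_bigr => j _.
transitivity (x j * (k == j)%:R); first by [].
by case: eqP => _; rewrite ?mulr1 ?mulr0.
Qed.

Lemma ell_normrE (x : ell p1) : (`|x|)%:E = Lnorm counting p (EFin \o x).
Proof. exact: ell_normE. Qed.

Lemma counting_setT_gt0 : (0 < @counting nat R [set: nat])%E.
Proof.
rewrite /counting; case: asboolP => // finT.
by case: (infinite_nat finT).
Qed.

(** For finite [p] one term is at most the sum of the series; for [p = +oo] a
    set that is negligible for the counting measure is empty. *)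
Lemma ell_coord_le (x : ell p1) k : `|x k| <= `|x|.
Proof.
rewrite -lee_fin ell_normrE; case: p p1 x => [r r1|r1|//] x.
- have r0 : 0 < r by rewrite (lt_le_trans ltr01).
  rewrite Lnorm_counting //.
  have -> : (`|x k|)%:E = ((`|(EFin \o x) k| `^ r) `^ r^-1)%E.
    by rewrite /= -powRrM mulfV ?gt_eqF // powRr1.
  apply: gt0_ler_poweR; first by rewrite invr_ge0 ltW.
  + by rewrite in_itv /= leey andbT lee_fin powR_ge0.
  + by rewrite in_itv /= leey andbT nneseries_ge0 // => *; exact: poweR_ge0.
  have := @nneseries_lim_ge R (fun k => `|(EFin \o x) k| `^ r)%E xpredT 0 k.+1
    (fun _ _ _ => poweR_ge0 _ _).
  apply: le_trans; rewrite big_nat_recr //= leeDr //.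
  by apply: sume_ge0 => i _; rewrite lee_fin powR_ge0.
- rewrite unlock counting_setT_gt0.
  have [A [_ A0 subA]] := ess_sup_ge counting (abse \o (EFin \o x)).
  rewrite leNgt; apply/negP => lt.
  have kA : [set k] `<=` A.
    by move=> _ ->; apply: subA => /= h; move: lt; rewrite ltNge h.
  have : (@counting nat R [set k] <= 0)%E.
    by rewrite -A0; exact: (@le_measure _ R nat counting _ _ (mem_set I) (mem_set I)).
  by rewrite /counting asboolT// fset_set1 cardfs1 lee_fin ler10.
Qed.

Lemma ell_coord_continuous k : continuous (fun x : ell p1 => x k).
Proof.
apply: (@nonexpansive_continuous R (ell p1) (fun x : ell p1 => x k)) => [x y|].
  by rewrite ell_valD -scaleN1r ell_valZ mulN1r.
by move=> z; have := ell_coord_le z k.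
Qed.

Lemma ell_coord_unit (n : nat) (x : 'I_n -> R) (j : 'I_n) :
  (\sum_(j < n) x j *: unit_seq j : ell p1) j = x j.
Proof.
rewrite ell_val_sum (bigD1 j) //= big1 ?addr0 // => i /andP[/eqP ij].
by rewrite -val_eqE /= ij eqxx.
Qed.

Lemma ell_coord_out (n : nat) (x : 'I_n -> R) (k : nat) : (n <= k)%N ->
  (\sum_(j < n) x j *: unit_seq j : ell p1) k = 0.
Proof.
move=> nk; rewrite ell_val_sum big1 // => j /eqP kj.
by move: nk; rewrite kj leqNgt ltn_ord.
Qed.

End SequenceSpaces.

Section UnitBallOfFiniteSums.
Variable R : realType.

Lemma ell_ball_fin (r : R) (r1 : (1 <= r%:E)%E) n (x : 'I_n -> R) :
  \sum_j `|x j| `^ r <= 1 -> `|\sum_(j < n) x j *: unit_seq j : ell r1| <= 1.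
Proof.
move=> h; rewrite -lee_fin ell_normrE.
have r0 : 0 < r by rewrite (lt_le_trans ltr01).
rewrite Lnorm_counting // (nneseries_split 0 n); last by move=> *; exact: poweR_ge0.
rewrite eseries0 ?adde0; last first.
  move=> k; rewrite add0n => nk _ /=.
  by rewrite ell_coord_out // normr0 powR0 // gt_eqF.
rewrite add0n big_mkord.
rewrite (eq_bigr (fun j => (`|x j| `^ r)%:E)); last first.
  by move=> j _ /=; rewrite ell_coord_unit.
rewrite sumEFin poweR_EFin lee_fin.
have -> : 1 = 1 `^ r^-1 :> R by rewrite powR1.
apply: ge0_ler_powR; rewrite ?nnegrE ?invr_ge0 ?(ltW r0) //.
by apply: sumr_ge0 => j _; exact: powR_ge0.
Qed.

Lemma ell_ball_inf (y1 : (1 <= +oo :> \bar R)%E) n (x : 'I_n -> R) :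
  (forall j, `|x j| <= 1) -> `|\sum_(j < n) x j *: unit_seq j : ell y1| <= 1.
Proof.
move=> h; rewrite -lee_fin ell_normrE unlock counting_setT_gt0.
apply/ess_supP; apply: nearW => k /=; rewrite lee_fin.
have [nk|kn] := leqP n k; first by rewrite ell_coord_out // normr0.
by rewrite (ell_coord_unit _ _ (Ordinal kn)).
Qed.

End UnitBallOfFiniteSums.

(** * The upper bound *)

(** Duality of [l_p] and [l_q] on finite sums: the extremal vector is
    proportional to [sg (b j) * |b j| ^ (q / p)], that is to [sg (b j)] if
    [p = +oo].  The equation on [q] says that [q] is conjugate to [p] and excludes
    [p = 1]. *)
Lemma dual_ball (R : realType) (p : \bar R) (p1 : (1 <= p)%E) (q N : R) n
    (b : 'I_n -> R) :
  1 <= q -> q^-1 = 1 - inv_exp p -> 0 <= N ->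
  (forall x : 'I_n -> R, `|\sum_(j < n) x j *: unit_seq j : ell p1| <= 1 ->
    \sum_j x j * b j <= N) ->
  \sum_j `|b j| `^ q <= N `^ q.
Proof.
move=> q1 qE N0 dual; have q0 : 0 < q by exact: lt_le_trans q1.
case: p p1 qE dual => [r r1|y1|//] /= qE dual; last first.
  have -> : q = 1 by rewrite -[q]invrK qE subr0 invr1.
  rewrite powRr1 //; apply: le_trans (dual (fun j => Num.sg (b j)) _).
    by apply: ler_sum => j _; rewrite powRr1 // normrEsg.
  by apply: ell_ball_inf => j; rewrite normr_sg; case: (_ != 0).
have r0 : 0 < r by rewrite (lt_le_trans ltr01).
set Z := \sum_j _.
have Z0 : 0 <= Z by apply: sumr_ge0 => j _; exact: powR_ge0.
have [->|Zn] := eqVneq Z 0; first exact: powR_ge0.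
have Zp : 0 < Z by rewrite lt_neqAle eq_sym Zn.
have bZ j : 0 <= `|b j| `^ q / Z by rewrite divr_ge0 ?powR_ge0.
pose x j := Num.sg (b j) * (`|b j| `^ q / Z) `^ r^-1.
suff h : Z `^ q^-1 <= N.
  have := @ge0_ler_powR R q (ltW q0) (Z `^ q^-1) N.
  by rewrite !nnegrE powR_ge0 N0 -powRrM mulVf ?gt_eqF // powRr1 //; apply.
apply: le_trans (dual x _).
  have -> : Z `^ q^-1 = Z * Z^-1 `^ r^-1.
    rewrite -(powR_inv1 Z0) -powRrM mulN1r qE powRD ?Zn ?implybT //.
    by rewrite powRr1.
  rewrite /Z mulr_suml; apply: ler_sum => j _; rewrite -/Z.
  rewrite /x powRM ?invr_ge0 ?powR_ge0 // -powRrM.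
  have -> B C : Num.sg (b j) * (B * C) * b j = `|b j| * B * C.
    by rewrite normrEsg; ring.
  have [->|bj] := eqVneq (b j) 0; first by rewrite normr0 powR0 ?gt_eqF ?mul0r.
  rewrite ler_wpM2r ?powR_ge0 //.
  have qE' : q = 1 + q / r.
    have := congr1 ( *%R q) qE; rewrite mulfV ?gt_eqF // mulrBr mulr1 => ->.
    by rewrite subrK.
  rewrite {1}qE' powRD ?powRr1 //.
  by rewrite normr_eq0 bj implybT.
apply: ell_ball_fin.
apply: (@le_trans _ _ (\sum_j (`|b j| `^ q / Z))); last first.
  by rewrite -mulr_suml divff.
apply: ler_sum => j _; rewrite /x normrM normr_sg ger0_norm ?powR_ge0 //.
have [bj|bj] := eqVneq (b j) 0; first by rewrite mul0r powR0 ?gt_eqF.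
by rewrite mul1r -powRrM mulVf ?gt_eqF // powRr1.
Qed.

Section Upper.
Variables (R : realType) (p : \bar R) (p1 : (1 <= p)%E).

Lemma form_bound (q N : R) (A : {bilinear ell p1 -> c0 R -> R}) n (y : 'I_n -> R) :
  1 <= q -> q^-1 = 1 - inv_exp p -> 0 <= N ->
  (forall x y, `|x| <= 1 -> `|y| <= 1 -> `|A x y| <= N) ->
  (forall k, `|y k| <= 1) ->
  \sum_(j < n) `|\sum_(k < n) y k * A (unit_seq j) (unit_seq k)| `^ q <= N `^ q.
Proof.
move=> q1 qE N0 AN y1; apply: (@dual_ball R p p1 q N n
  (fun j => \sum_(k < n) y k * A (unit_seq j) (unit_seq k)) q1 qE N0) => x x1.
have := AN _ _ x1 (ell_ball_inf _ y1).
move=> /(le_trans (ler_norm _)); rewrite linear_sumlz.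
congr (_ <= _); apply: eq_bigr => j _; rewrite linearZl_LR linear_sumr /=.
by congr (_ * _); apply: eq_bigr => k _; rewrite linearZr_LR.
Qed.

Lemma esum_square_le (a : nat -> nat -> R) (M : R) :
  (forall j k, 0 <= a j k) ->
  (forall n, \sum_(j < n) \sum_(k < n) a j k <= M) ->
  (\esum_(jk in [set: nat * nat]) (a jk.1 jk.2)%:E <= M%:E)%E.
Proof.
move=> a0 aM; apply: ub_ereal_sup => _ [F [finF _] <-].
rewrite fsbig_finite //= sumEFin lee_fin.
pose n := (\max_(jk <- fset_set F) maxn jk.1 jk.2).+1.
apply: le_trans (aM n).
rewrite -(big_mkord xpredT (fun j => \sum_(k < n) a j k)).
under [leRHS]eq_bigr do rewrite -(big_mkord xpredT (a _)).
rewrite -(@big_allpairs _ _ _ _ _ _ _ (fun jk => a jk.1 jk.2)).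
set s := fset_set F; set s' := [seq _ | _ <- _, _ <- _].
have ss' : {subset s <= s'}.
  move=> [j k] jkF; apply/allpairsP; exists (j, k).
  have := leq_bigmax_seq (P := xpredT) (F := fun jk : nat * nat => maxn jk.1 jk.2) (j, k) jkF isT.
  by rewrite /= geq_max !mem_index_iota !ltnS => /andP[].
have us' : uniq s' by apply: allpairs_uniq; rewrite ?iota_uniq // => -[? ?] [].
have ss : perm_eq [seq jk <- s' | jk \in s] s.
  apply: uniq_perm; rewrite ?filter_uniq // => jk.
  by rewrite mem_filter andb_idr // => /ss'.
rewrite [leRHS](bigID (mem s)) /= -[X in _ <= X + _]big_filter.
by rewrite (perm_big _ ss) /= lerDl; apply: sumr_ge0.
Qed.

Lemma HL_exp_conjugate (q : R) : 0 < q -> q^-1 = 1 - inv_exp p ->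
  HL_exp p = 4 * q / (q + 2).
Proof.
move=> q0 qE; have -> : 4 * q / (q + 2) = 4 / (1 + 2 * q^-1).
  by field; rewrite !gt_eqF //; lra.
rewrite qE; case: p p1 => [r|y1|//] /=; last first.
  by field.
rewrite lee_fin => r1; have r0 : r != 0 by rewrite gt_eqF //; lra.
by field; rewrite r0 /=; lra.
Qed.

(** The finite inequality applies to every square section of the matrix of the
    form.  A form of infinite norm satisfies the inequality because the constant
    is positive. *)
Lemma HL_constant_upper (q : R) : 1 <= q <= 2 -> q^-1 = 1 - inv_exp p ->
  HL_constant p1 (2 `^ (1 / 2 - inv_exp p / 2)).
Proof.
move=> q12 qE A _; have /andP[q1 q2] := q12.
have q0 : 0 < q by lra.
have HLE := HL_exp_conjugate q0 qE.
have r0 : 0 < HL_exp p by rewrite HLE divr_gt0 //; lra.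
have C0 : 0 < 2 `^ (1 / 2 - inv_exp p / 2) :> R by exact: powR_gt0.
have CE : 1 / 2 - inv_exp p / 2 = 1 / (2 * q).
  by rewrite div1r invfM qE; field.
have unit_le x y : `|x| <= 1 -> `|y| <= 1 -> ((`|A x y|)%:E <= bilin_norm A)%E.
  by move=> x1 y1; apply: ereal_sup_ubound; exists x => //; exists y.
have N0 : (0 <= bilin_norm A)%E.
  have := unit_le 0 0; rewrite !normr0 => /(_ ler01 ler01); apply: le_trans.
  by rewrite lee_fin.
case NE : (bilin_norm A) N0 unit_le => [N| |] // N0 AN; last first.
  by rewrite mulry gtr0_sg // mul1e leey.
rewrite lee_fin in N0.
have {}AN x y : `|x| <= 1 -> `|y| <= 1 -> `|A x y| <= N.
  by move=> x1 y1; have := AN x y x1 y1; rewrite lee_fin.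
have CN0 : 0 <= 2 `^ (1 / 2 - inv_exp p / 2) * N by rewrite mulr_ge0 // ltW.
have := @esum_square_le (fun j k => `|A (unit_seq j) (unit_seq k)| `^ HL_exp p)
  ((2 `^ (1 / 2 - inv_exp p / 2) * N) `^ HL_exp p) (fun _ _ => powR_ge0 _ _).
move=> le; apply: (@le_trans _ _ (((2 `^ (1 / 2 - inv_exp p / 2) * N) `^ HL_exp p)%:E `^ (HL_exp p)^-1)%E).
  apply: gt0_ler_poweR; first by rewrite invr_ge0 ltW.
  + by rewrite in_itv /= leey andbT esum_ge0 // => *; rewrite lee_fin powR_ge0.
  + by rewrite in_itv /= leey andbT lee_fin powR_ge0.
  apply: le => n.
  have := @finite_hardy_littlewood R 'I_n 'I_n
    (fun j k => A (unit_seq j) (unit_seq k)) q N q12 N0.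
  rewrite -HLE -CE => fin.
  have {}fin := fin (fun y y1' => form_bound q1 qE N0 AN y1').
  set S := \sum_j _ in fin *.
  have S0 : 0 <= S by do 2![apply: sumr_ge0 => ? _]; exact: powR_ge0.
  have := @ge0_ler_powR R (HL_exp p) (ltW r0) (S `^ (HL_exp p)^-1) _.
  move=> /(_ _ _ _ fin); rewrite -powRrM mulVf ?gt_eqF // powRr1 //.
  by apply; rewrite nnegrE // powR_ge0.
by rewrite poweR_EFin -powRrM mulfV ?gt_eqF // powRr1.
Qed.
End Upper.

(** * The lower bound and the optimal constant *)

Definition hadamard_form (R : realType) (p : \bar R) (p1 : (1 <= p)%E)
    (x : ell p1) (y : c0 R) : R :=
  x 0%N * (y 0%N + y 1%N) + x 1%N * (y 0%N - y 1%N).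

Lemma hadamard_form_bilinear (R : realType) (p : \bar R) (p1 : (1 <= p)%E) :
  bilinear_for *%R *%R (@hadamard_form R p p1).
Proof.
by split=> [y|x] a u v; rewrite /hadamard_form !(ell_valD, ell_valZ) /=; ring.
Qed.

HB.instance Definition _ (R : realType) (p : \bar R) (p1 : (1 <= p)%E) :=
  bilinear_isBilinear.Build R (ell p1) (c0 R) R *%R *%R
    (@hadamard_form R p p1) (@hadamard_form_bilinear R p p1).

Section Lower.
Variables (R : realType) (p : \bar R) (p1 : (1 <= p)%E).

Lemma hadamard_form_continuous :
  continuous (fun z : ell p1 * c0 R => hadamard_form z.1 z.2).
Proof.
have cx k : continuous (fun z : ell p1 * c0 R => z.1 k).
  move=> z; apply: (@continuous_comp _ _ _ fst (fun x : ell p1 => x k)).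
    exact: cvg_fst.
  exact: ell_coord_continuous.
have cy k : continuous (fun z : ell p1 * c0 R => z.2 k).
  move=> z; apply: (@continuous_comp _ _ _ snd (fun x : c0 R => x k)).
    exact: cvg_snd.
  exact: ell_coord_continuous.
move=> z; apply: cvgD; apply: cvgM; [exact: cx| |exact: cx|].
  by apply: cvgD; exact: cy.
by apply: cvgB; exact: cy.
Qed.

(** [|y0 + y1| + |y0 - y1| = 2 max (|y0|, |y1|)]. *)
Lemma hadamard_form_norm : (bilin_norm (@hadamard_form R p p1) <= 2%:E)%E.
Proof.
apply: ub_ereal_sup => _ [x /= x1 [y /= y1 <-]]; rewrite lee_fin /hadamard_form.
have x0 := le_trans (ell_coord_le x 0) x1.
have {}x1 := le_trans (ell_coord_le x 1) x1.
have y0 := le_trans (ell_coord_le y 0) y1.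
have {}y1 := le_trans (ell_coord_le y 1) y1.
apply: (@le_trans _ _ (`|y 0%N + y 1%N| + `|y 0%N - y 1%N|)).
  rewrite (le_trans (ler_normD _ _)) // !normrM.
  by rewrite lerD // ler_piMl.
move: y0 y1; rewrite !ler_norml => /andP[a1 a2] /andP[b1 b2].
have [h1|h1] := ler0P (y 0%N + y 1%N); have [h2|h2] := ler0P (y 0%N - y 1%N); lra.
Qed.

Lemma hadamard_form_esum (r : R) :
  ((4 : R)%:E <= \esum_(jk in [set: nat * nat])
    (`|@hadamard_form R p p1 (unit_seq jk.1) (unit_seq jk.2)| `^ r)%:E)%E.
Proof.
pose s : seq (nat * nat) := [:: (0, 0); (0, 1); (1, 0); (1, 1)]%N.
apply: (@le_trans _ _ (\sum_(jk \in [set` s])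
    (`|@hadamard_form R p p1 (unit_seq jk.1) (unit_seq jk.2)| `^ r)%:E)%E).
  rewrite -fsbig_seq //= sumEFin lee_fin !big_cons big_nil /hadamard_form /=.
  rewrite !(mul1r, mul0r, add0r, addr0, subr0, sub0r) !normrN !normr1 !powR1.
  by lra.
apply: ereal_sup_ubound; exists [set` s] => //; split => //.
exact: finite_seq.
Qed.

Lemma HL_constant_lower (q C : R) : 1 <= q -> q^-1 = 1 - inv_exp p ->
  HL_constant p1 C -> 2 `^ (1 / 2 - inv_exp p) <= C.
Proof.
move=> q1 qE /(_ _ hadamard_form_continuous); have q0 : 0 < q by lra.
have HLE := HL_exp_conjugate p1 q0 qE.
have r0 : 0 < HL_exp p by rewrite HLE divr_gt0 //; lra.
have rE : (HL_exp p)^-1 = 3 / 4 - inv_exp p / 2.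
  rewrite HLE (_ : inv_exp p = 1 - q^-1); last by rewrite qE; ring.
  by field; rewrite !gt_eqF //; lra.
have lhs : ((4 `^ (HL_exp p)^-1)%:E <= (\esum_(jk in [set: nat * nat])
    (`|@hadamard_form R p p1 (unit_seq jk.1) (unit_seq jk.2)| `^ HL_exp p)%:E)
      `^ (HL_exp p)^-1)%E.
  rewrite -poweR_EFin; apply: gt0_ler_poweR; rewrite ?invr_ge0 ?(ltW r0) //.
  + by rewrite in_itv /= leey andbT lee_fin; lra.
  + by rewrite in_itv /= leey andbT esum_ge0 // => *; rewrite lee_fin powR_ge0.
  exact: hadamard_form_esum.
move=> /(le_trans lhs); have := hadamard_form_norm.
have : (0 <= bilin_norm (@hadamard_form R p p1))%E.
  apply: ereal_sup_ubound; exists 0; rewrite /= ?normr0 //.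
  by exists 0; rewrite /= ?normr0 // /hadamard_form !ell_val0 !mul0r addr0 normr0.
case: bilin_norm => [N| |] //; rewrite -EFinM !lee_fin => N0 N2 le.
have e : 4 `^ (HL_exp p)^-1 = 2 * 2 `^ (1 / 2 - inv_exp p) :> R.
  have -> : 4 = 2 `^ 2 :> R by rewrite powR_mulrn //; ring.
  rewrite -powRrM (_ : 2 * _^-1 = 1 + (1 / 2 - inv_exp p)); last first.
    by rewrite rE; field.
  by rewrite powRD ?powRr1 // pnatr_eq0 implybT.
have c0 : 0 < 2 `^ (1 / 2 - inv_exp p) :> R by exact: powR_gt0.
rewrite {}e in le; have [C0|C0] := ltP C 0.
  by have := mulr_le0_ge0 (ltW C0) N0; lra.
by have := ler_wpM2l C0 N2; lra.
Qed.

(** The infimum of the admissible constants is admissible: for a form of finite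
    norm the inequality passes to the limit, and for a form of infinite norm it
    holds because the infimum is positive. *)
Lemma optimal_HL_constant_exists (c C : R) : 0 < c ->
  (forall D, HL_constant p1 D -> c <= D) -> HL_constant p1 C ->
  exists D, optimal_HL_constant p1 D.
Proof.
move=> c0 cD CC; pose S := [set D | HL_constant p1 D].
have S0 : S !=set0 by exists C.
have Sc : has_lbound S by exists c => D; exact: cD.
exists (inf S); split; last by move=> D SD; exact: ge_inf.
have infc : c <= inf S by apply: lb_le_inf.
move=> A cA.
have N0 : (0 <= bilin_norm A)%E.
  apply: (@le_trans _ _ (`|A 0 0|)%:E); first by rewrite lee_fin.
  by apply: ereal_sup_ubound; exists 0; rewrite /= ?normr0 //; exists 0; rewrite /= ?normr0.
case NE : (bilin_norm A) N0 => [N| |] // N0; last first.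
  by rewrite mulry gtr0_sg ?mul1e ?leey //; exact: lt_le_trans infc.
rewrite lee_fin in N0.
(* L stands for the left-hand side, finite thanks to the admissible constant C *)
suff inf_bound (L : \bar R) : (0 <= L)%E ->
    (forall D, S D -> (L <= D%:E * N%:E)%E) -> (L <= (inf S)%:E * N%:E)%E.
  by apply: inf_bound => [|D SD]; [exact: poweR_ge0 | rewrite -NE; exact: SD].
case: L => [L| |] // L0 SA; last by have := SA C CC; rewrite -EFinM.
rewrite -EFinM lee_fin.
have [N00|Np] := eqVneq N 0; first by have := SA C CC; rewrite N00 mule0 mulr0 lee_fin.
have {Np N0}Np : 0 < N by rewrite lt_neqAle eq_sym Np.
rewrite -ler_pdivrMr //; apply: lb_le_inf => // D SD.
by rewrite ler_pdivrMr // -lee_fin EFinM; exact: SA.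
Qed.
End Lower.

Theorem mainTheorem3 (R : realType) (p0 : R) (p0_gt1 : 1 < p0) (p0_lt2 : p0 < 2)
    (p0_Gamma : Gamma ((p0 + 1) / 2) = Num.sqrt pi / 2)
    (p : \bar R) (p1 : (1 <= p)%E) (p_ge : ((p0 / (p0 - 1))%:E <= p)%E) :
  exists C : R, [/\ optimal_HL_constant p1 C,
    2 `^ (1 / 2 - inv_exp p) <= C &
    C <= 2 `^ (1 / 2 - inv_exp p / 2)].
Proof.
(* since p0 < 2, p exceeds 2 and its conjugate exponent q is at most 2 *)
have [q q12 qE] : exists2 q : R, 1 <= q <= 2 & q^-1 = 1 - inv_exp p.
  case: p p1 p_ge => [r r1|y1|//] /=; last first.
    by move=> _; exists 1; [lra | rewrite invr1 subr0].
  rewrite lee_fin ler_pdivrMr; last by lra.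
  move=> rp; have r2 : 2 < r by nra.
  exists (r / (r - 1)); last by field; lra.
  by rewrite ler_pdivlMr ?ler_pdivrMr; lra.
have /andP[q1 _] := q12.
have upper := @HL_constant_upper R p p1 q q12 qE.
have lower D : HL_constant p1 D -> _ := @HL_constant_lower R p p1 q D q1 qE.
have c0 : 0 < 2 `^ (1 / 2 - inv_exp p) :> R by exact: powR_gt0.
have [C Copt] := optimal_HL_constant_exists c0 lower upper.
by exists C; split; [exact: Copt | exact: lower Copt.1 | exact: Copt.2 upper].
Qed.
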